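(* Let $1\le p<\infty$, let $k\ge1$ be a fixed integer, and for each $N\ge k$ let $X=X_N$ have the $p$-Generalized Dirichlet distribution on $\mathbb{B}_{N,p}$ with parameter $(\mathbf a,\mathbf b)=(a_1,\dots,a_N,b_1,\dots,b_N)$ (all positive), where $a_1,\dots,a_k$ do not depend on $N$ while the $b_j=b_j^{(N)}$ may depend on $N$. Let $X^{(k)}=(X_1,\dots,X_k)$. Assume that, for $j=1,\dots,k$, $p\,b_j=N+o(N)$ as $N\to\infty$. Then, as $N\to\infty$, $(X^{(k)})$ satisfies a large deviations principle on $\mathbb{B}_{k,p}$ with speed $N$ and good rate function $$I(x)=-\frac1p\ln\big(1-\|x\|_p^p\big),\qquad x\in\mathbb{B}_{k,p}.$$
   Context: $\mathbb{B}_{N,p}=\{x\in\mathbb{R}^N:\|x\|_p=(\sum_{i=1}^N|x_i|^p)^{1/p}<1\}$. $\mathcal{S}_N^<=\{(x_1,\dots,x_N):x_i>0\ \forall i,\ \sum_i x_i<1\}$, and $\mathcal{GD}_{\mathbf a,\mathbf b}$ is the probability distribution on $\mathcal{S}_N^<$ with Lebesgue density $$\frac1{\mathcal{Z}(\mathbf a,\mathbf b)}\,p_{N+1}^{b_N-1}\prod_{j=1}^N\Big[p_j^{a_j-1}(1-p_1-\dots-p_{j-1})^{b_{j-1}-(a_j+b_j)}\Big],\qquad p_{N+1}=1-p_1-\dots-p_N,$$ with $\mathcal{Z}(\mathbf a,\mathbf b)=\prod_{j=1}^N\Gamma(a_j)\Gamma(b_j)/\Gamma(a_j+b_j)$ (for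 $j=1$ the base of the last power is $1$, so $b_0$ plays no role). The $p$-Generalized Dirichlet distribution on $\mathbb{B}_{N,p}$ with parameter $(\mathbf a,\mathbf b)$ is the law of $(\varepsilon_1\rho_1^{1/p},\dots,\varepsilon_N\rho_N^{1/p})$, where $(\rho_1,\dots,\rho_N)$ has distribution $\mathcal{GD}_{\mathbf a,\mathbf b}$ and the $\varepsilon_i$ are independent Rademacher variables ($\pm1$ with probability $1/2$), independent of $(\rho_1,\dots,\rho_N)$. A sequence $(Y_N)$ of random elements of a topological space $E$ satisfies the large deviations principle with speed $N$ and good rate function $I:E\to[0,\infty]$ if $I$ has compact sublevel sets, $\limsup_N\frac1N\ln\mathbb{P}(Y_N\in F)\le-\inf_FI$ for all closed $F\subset E$, and $\liminf_N\frac1N\ln\mathbb{P}(Y_N\in O)\ge-\inf_OI$ for all open $O\subset E$. *)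

(* Defs.v *)
From HB Require Import structures.
From mathcomp Require Import all_boot all_order all_algebra.
From mathcomp Require Import all_classical all_reals all_analysis.
From mathcomp Require Import measurable_realfun.

Set Implicit Arguments.
Unset Strict Implicit.
Unset Printing Implicit Defensive.

Import Order.TTheory GRing.Theory Num.Def Num.Theory.
Import numFieldNormedType.Exports.

Local Open Scope classical_set_scope.
Local Open Scope ring_scope.

Section tuple_measure.
Context d (T : measurableType d) (R : realType).
Local Open Scope ereal_scope.

Definition tuple_cons n (q : T * n.-tuple T) : n.+1.-tuple T :=
  [tuple of q.1 :: q.2].

Lemma measurable_tuple_cons n :
  measurable_fun [set: T * n.-tuple T] (@tuple_cons n).
Proof. exact: measurable_cons. Qed.

Lemma tuple_cons_bij n : exists g : n.+1.-tuple T -> T * n.-tuple T,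
  [/\ measurable_fun setT g, cancel (@tuple_cons n) g & cancel g (@tuple_cons n)].
Proof.
exists (fun t => (thead t, [tuple of behead t])); split.
- apply/measurable_fun_pairP; split; last exact: measurable_behead.
  exact: measurable_tnth.
- by move=> [x t]; congr pair; apply/val_inj.
- by move=> t; rewrite /tuple_cons/= [RHS]tuple_eta.
Qed.

Variable m : {sigma_finite_measure set T -> \bar R}.

Section step.
Variables (n : nat) (mu : {sigma_finite_measure set (n.-tuple T) -> \bar R}).

Definition cons_measure : set (n.+1.-tuple T) -> \bar R :=
  pushforward (m \x mu) (@tuple_cons n).

Let cons0 : cons_measure set0 = 0.
Proof. by rewrite /cons_measure /pushforward preimage_set0 measure0. Qed.

Let cons_ge0 A : 0 <= cons_measure A. Proof. by rewrite /cons_measure /pushforward measure_ge0. Qed.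

Let cons_sigma_additive : semi_sigma_additive cons_measure.
Proof.
move=> F mF tF mUF; rewrite /cons_measure /pushforward preimage_bigcup.
apply: measure_semi_sigma_additive.
- by move=> i; rewrite -[X in measurable X]setTI; exact: measurable_tuple_cons.
- apply/trivIsetP => /= i j _ _ ij; rewrite -preimage_setI.
  by move/trivIsetP : tF => /(_ _ _ _ _ ij) ->//; rewrite preimage_set0.
- rewrite -preimage_bigcup -[X in measurable X]setTI.
  exact: measurable_tuple_cons.
Qed.

HB.instance Definition _ := isMeasure.Build _ _ _ cons_measure
  cons0 cons_ge0 cons_sigma_additive.

Let cons_sigma_finite : sigma_finite setT cons_measure.
Proof.
have [F FT Foo] : sigma_finite setT (m \x mu).
  have /sigma_finiteP[F [TF ndF Foo]] := sigma_finiteT m.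
  have /sigma_finiteP[G [TG ndG Goo]] := sigma_finiteT mu.
  exists (fun i => F i `*` G i).
    rewrite -setXTT TF TG predeqE => -[x y]; split.
      move=> [/= [i _ Fnx] [j _ Gky]]; exists (maxn i j) => //; split.
      - by move: x Fnx; exact/subsetPset/ndF/leq_maxl.
      - by move: y Gky; exact/subsetPset/ndG/leq_maxr.
    by move=> [i _ []/= ? ?]; split; exists i.
  move=> i; have [? ?] := Foo i; have [? ?] := Goo i.
  split; first exact: measurableX.
  by rewrite product_measure1E// lte_mul_pinfty// ge0_fin_numE.
have [g [mg cg gc]] := tuple_cons_bij n.
exists (fun i => g @^-1` F i).
  by rewrite -preimage_bigcup -FT preimage_setT.
move=> i; have [mFi Fioo] := Foo i; split.
  by rewrite -[X in measurable X]setTI; exact: mg.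
rewrite /cons_measure /pushforward -comp_preimage.
by rewrite (_ : g \o _ = id)//; apply/funext => q /=; rewrite cg.
Qed.

HB.instance Definition _ :=
  Measure_isSigmaFinite.Build _ _ _ cons_measure cons_sigma_finite.

End step.

(* n-fold product of m with itself, see tuple_measure_box *)
Fixpoint tuple_measure n : {sigma_finite_measure set (n.-tuple T) -> \bar R} :=
  match n with
  | 0 => \d_([tuple])
  | n'.+1 => cons_measure (tuple_measure n')
  end.

Lemma tuple_measure_box n (A : 'I_n -> set T) : (forall i, measurable (A i)) ->
  tuple_measure n [set t | forall i, A i (tnth t i)] = \prod_(i < n) m (A i).
Proof.
elim: n A => [|n ih] A mA.
  rewrite big_ord0 /= diracE mem_set//; by case.
rewrite big_ord_recl -ih//= /cons_measure /pushforward.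
rewrite -product_measure1E//.
- congr (_ _); apply/seteqP; split=> [[x t] /= h|[x t] /= [h0 h] i].
    by split=> [|i]; [exact: (h ord0)|have := h (lift ord0 i); rewrite tnthS].
  by case: (unliftP ord0 i) => [j|] ->; rewrite ?tnthS//=; exact: h.
- rewrite (_ : [set _ | _] =
    \bigcap_(i in [set: 'I_n]) ((@tnth _ T)^~ i @^-1` A (lift ord0 i))).
    apply: fin_bigcap_measurable => // i _; rewrite -[X in measurable X]setTI.
    exact: measurable_tnth.
  by apply/seteqP; split=> t /= h i; [move=> _; exact: h|exact: h].
Qed.

End tuple_measure.

Section generalized_dirichlet.
Context {R : realType}.

Definition Gamma (s : R) : R :=
  (\int[lebesgue_measure]_(t in `]0, +oo[) (t `^ (s - 1) * expR (- t)))%R.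

Definition open_simplex n : set (n.-tuple R) :=
  [set x | (forall i, 0 < tnth x i) /\ \sum_(i < n) tnth x i < 1].

Local Arguments open_simplex : clear implicits.

(* Parameters are indexed as on paper: only a 1, ..., a n and b 1, ..., b n are
   relevant. The ordinal j : 'I_n stands for the paper's index j.+1; b 0 only
   occurs as an exponent of 1. *)
Definition GD_const n (a b : nat -> R) : R :=
  \prod_(1 <= j < n.+1) (Gamma (a j) * Gamma (b j) / Gamma (a j + b j)).

Definition GD_density n (a b : nat -> R) (x : n.-tuple R) : R :=
  (GD_const n a b)^-1 * (1 - \sum_(i < n) tnth x i) `^ (b n - 1) *
  \prod_(j < n) (tnth x j `^ (a j.+1 - 1) *
    (1 - \sum_(i < n | (i < j)%N) tnth x i) `^ (b j - (a j.+1 + b j.+1))).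

Definition GD n (a b : nat -> R) : set (n.-tuple R) -> \bar R := fun A =>
  (\int[tuple_measure lebesgue_measure n]_(x in A `&` open_simplex n)
    (GD_density a b x)%:E)%E.

Lemma measurable_open_simplex n : measurable (open_simplex n).
Proof.
rewrite (_ : open_simplex n =
  (\bigcap_(i in [set: 'I_n]) ((@tnth _ R)^~ i @^-1` `]0, +oo[%classic)) `&`
  ((fun x : n.-tuple R => \sum_(i < n) tnth x i) @^-1` `]-oo, 1[%classic)).
  apply: measurableI.
    apply: fin_bigcap_measurable => // i _; rewrite -[X in measurable X]setTI.
    exact: measurable_tnth.
  rewrite -[X in measurable X]setTI.
  by apply: measurable_sum => // i; exact: measurable_tnth.
apply/seteqP; split=> x; rewrite /open_simplex/= in_itv/=.
  by move=> [h ?]; split=> // i _ /=; rewrite in_itv/= h.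
by move=> [h ?]; split=> // i; have := h i I; rewrite /= in_itv/= andbT.
Qed.

Lemma measurable_GD_density n a b :
  measurable_fun [set: n.-tuple R] (@GD_density n a b).
Proof.
have mt (i : 'I_n) : measurable_fun [set: n.-tuple R] ((@tnth _ R)^~ i).
  exact: measurable_tnth.
have mS (D : pred 'I_n) : measurable_fun [set: n.-tuple R]
    (fun x => 1 - \sum_(i < n | D i) tnth x i).
  apply: measurable_funB => //.
  under eq_fun do rewrite big_mkcond/=.
  by apply: measurable_sum => i; case: (D i).
apply: measurable_funM.
  apply: measurable_funM => //.
  exact: (measurableT_comp (measurable_powR _) (mS xpredT)).
apply: measurable_prod => j _; apply: measurable_funM.
  exact: (measurableT_comp (measurable_powR _) (mt j)).
exact: (measurableT_comp (measurable_powR _) (mS _)).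
Qed.

Lemma Gamma_ge0 s : 0 <= Gamma s.
Proof.
by apply: Rintegral_ge0 => t _; rewrite mulr_ge0 ?powR_ge0 ?expR_ge0.
Qed.

Lemma GD_density_ge0 n a b (x : n.-tuple R) : 0 <= GD_density a b x.
Proof.
rewrite !mulr_ge0 ?powR_ge0//.
  rewrite invr_ge0; apply: prodr_ge0 => j _.
  by rewrite !mulr_ge0 ?invr_ge0 ?Gamma_ge0.
by apply: prodr_ge0 => j _; rewrite mulr_ge0 ?powR_ge0.
Qed.

Section GD_measure.
Variables (n : nat) (a b : nat -> R).

Let GD0 : GD a b (@set0 (n.-tuple R)) = 0%E.
Proof. by rewrite /GD set0I integral_set0. Qed.

Let GD_ge0 A : (0 <= @GD n a b A)%E.
Proof.
by apply: integral_ge0 => x _; rewrite lee_fin GD_density_ge0.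
Qed.

Let GD_sigma_additive : semi_sigma_additive (@GD n a b).
Proof.
move=> F mF tF mUF; apply: cvg_toP.
  apply: ereal_nondecreasing_is_cvgn => i j ij.
  by apply: lee_sum_nneg_natr => // k _ _; exact: GD_ge0.
rewrite /GD setI_bigcupl ge0_integral_bigcup//=.
- move=> k; apply: measurableI; [exact: mF|exact: measurable_open_simplex].
- apply/measurable_funTS/measurableT_comp => //.
  exact: measurable_GD_density.
- by move=> x _; rewrite lee_fin GD_density_ge0.
- exact: trivIset_setIr.
Qed.

HB.instance Definition _ := isMeasure.Build _ _ _ (@GD n a b)
  GD0 GD_ge0 GD_sigma_additive.

End GD_measure.

(* Law of (eps_i * rho_i ^ (1 / p))_i with rho ~ GD and eps a vector of
   independent signs, independent of rho: the pair (rho, eps) is distributed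
   according to a product measure, and a fair bit c encodes the sign (-1) ^ c. *)
Definition pGD n (p : R) (a b : nat -> R) : set (n.-tuple R) -> \bar R :=
  pushforward (@GD n a b \x tuple_measure (bernoulli_prob (2^-1 : R)) n)%E
    (fun q => [tuple (-1) ^+ tnth q.2 i * tnth q.1 i `^ p^-1 | i < n]).

Definition pnorm n (p : R) (x : 'rV[R]_n) : R :=
  (\sum_(i < n) `|x 0 i| `^ p) `^ p^-1.

Definition pball n (p : R) : set 'rV[R]_n := [set x | pnorm p x < 1].

Local Arguments pball : clear implicits.

Definition coords {n} {p : R} (x : pball n p) : n.-tuple R :=
  [tuple set_val x 0 i | i < n].

Definition has_pGD_law d (T : measurableType d) (P : probability T R) n (p : R)
    (a b : nat -> R) (X : T -> pball n p) : Prop :=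
  measurable_fun [set: T] (coords \o X) /\
  forall A : set (n.-tuple R), measurable A ->
    pushforward P (coords \o X) A = pGD p a b A.

Definition pad n k (x : 'rV[R]_n) : 'rV[R]_k :=
  \row_(i < k) (if insub (val i) is Some j then x 0 j else 0).

Lemma pad_pball n k p (x : 'rV[R]_n) : 1 <= p -> pball n p x -> pball k p (pad k x).
Proof.
move=> p1; have p0 : 0 < p by rewrite (lt_le_trans _ p1).
apply: le_lt_trans; apply: ge0_ler_powR.
- by rewrite invr_ge0 ltW.
- by rewrite nnegrE sumr_ge0// => i _; rewrite powR_ge0.
- by rewrite nnegrE sumr_ge0// => i _; rewrite powR_ge0.
pose f i := if insub i is Some j then `|x 0 j| `^ p else 0.
have f0 i : 0 <= f i by rewrite /f; case: insubP => // j _ _; rewrite powR_ge0.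
have fO i : (n <= i)%N -> f i = 0 by move=> ni; rewrite /f insubN// -leqNgt.
rewrite (eq_bigr (fun i : 'I_k => f i)); last first.
  move=> i _; rewrite mxE /f; case: insubP => // _.
  by rewrite normr0 powR0// gt_eqF.
rewrite [leRHS](eq_bigr (fun i : 'I_n => f i)); last first.
  by move=> i _; rewrite /f valK.
rewrite -!(big_mkord xpredT f).
have [kn|nk] := leqP k n.
  by rewrite (@big_cat_nat _ _ _ k _ n)//= lerDl sumr_ge0.
rewrite (@big_cat_nat _ _ _ n _ k)//=; last exact: ltnW.
by rewrite [X in _ + X]big_nat_cond [X in _ + X]big1 ?addr0// => i /andP[/andP[/fO]].
Qed.

(* The first k coordinates of a point of the ball of R^n. When n < k, a case
   that never matters asymptotically, they are completed by zeros. *)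
Definition first_coords {n} k {p : R} (hp : 1 <= p) (x : pball n p) : pball k p :=
  SigSub (mem_set (pad_pball k hp (set_valP x))).

End generalized_dirichlet.

Arguments open_simplex {R} n _.
Arguments GD {R} n a b _.
Arguments pGD {R} n p a b _.
Arguments pball {R} n p _.

(* The speed is N. As lne 0 = -oo, null events need no special treatment. Events
   are preimages of closed or open sets, so the predicate is meant for Borel
   measurable Y N, which it does not itself require. *)
Definition LDP (R : realType) (E : topologicalType) (d : nat -> measure_display)
    (T : forall N, measurableType (d N)) (P : forall N, probability (T N) R)
    (Y : forall N, T N -> E) (I : E -> \bar R) : Prop :=
  [/\ forall x, (0 <= I x)%E,
      forall c : R, compact [set x | (I x <= c%:E)%E],
      forall F : set E, closed F ->
        (limn_esup (fun N => (N%:R^-1)%:E * lne (P N (Y N @^-1` F)))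
          <= - ereal_inf (I @` F))%E
    & forall O : set E, open O ->
        (- ereal_inf (I @` O) <=
          limn_einf (fun N => (N%:R^-1)%:E * lne (P N (Y N @^-1` O))))%E].

(* Main.v *)
From HB Require Import structures.
Require Import Defs.
From mathcomp Require Import all_boot all_order all_algebra.
From mathcomp Require Import all_classical all_reals all_analysis.
From mathcomp Require Import measurable_realfun ring lra.
Import Order.TTheory GRing.Theory Num.Def Num.Theory.
Import numFieldNormedType.Exports.
Local Open Scope classical_set_scope.
Local Open Scope ring_scope.

(** Stick breaking: up to normalisation, the generalized Dirichlet density is a
    product of Beta densities in the ratios rho_j / (1 - rho_1 - ... -
    rho_(j-1)), so its integral over the simplex is a product of Beta integrals
    B(a_j, b_j). As the law is given to be a probability, this product is the
    normalising constant, and no relation between Beta and Gamma is needed.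
    Lowering b_1, ..., b_k by l multiplies the density by
    (1 - rho_1 - ... - rho_k)^(-l); with l close to N / p this is an
    exponential Chebyshev bound giving
    P(rho_1 + ... + rho_k >= r) <= (1 - r)^l prod_j B(a_j, b_j - l) / B(a_j, b_j),
    where the quotient of Beta integrals is subexponential because the a_j are
    fixed. Conversely a box with s + sum v_j <= 1 has probability at least
    C s^(max b_j). Since |X_j|^p = rho_j, the two bounds give the upper bound on
    closed sets and, through small boxes, the lower bound on open sets. *)

Set Implicit Arguments.
Unset Strict Implicit.
Unset Printing Implicit Defensive.

(** * The generalized Dirichlet density by stick breaking *)

Lemma integral_tuple_cons d (T : measurableType d) (R : realType)
    (m : {sigma_finite_measure set T -> \bar R}) n
    (f : n.+1.-tuple T -> \bar R) :
  measurable_fun [set: n.+1.-tuple T] f -> (forall t, (0 <= f t)%E) ->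
  (\int[tuple_measure m n.+1]_t f t =
   \int[m]_x \int[tuple_measure m n]_t f (tuple_cons (x, t)))%E.
Proof.
move=> mf f0.
rewrite [LHS](@ge0_integral_pushforward _ _ _ _ _ (@tuple_cons _ T n)
  (@measurable_tuple_cons _ T n) (m \x tuple_measure m n)%E setT f measurableT mf)//.
rewrite preimage_setT (fubini_tonelli1 (f \o @tuple_cons _ T n))//.
  exact: (measurableT_comp mf (@measurable_tuple_cons _ T n)).
by move=> x; exact: f0.
Qed.

Section stick_breaking.
Context {R : realType}.
Local Notation leb := (@lebesgue_measure R).
Implicit Types (S : R) (a b : nat -> R) (t : seq R).

(* The unnormalised density on the simplex of size S; its first factor has an
   exponent involving b 0, which is harmless since S = 1 in the end. *)
Fixpoint stick S a b t : R :=
  if t is x :: t' then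
    if 0 < x < S then
      x `^ (a 1%N - 1) * S `^ (b 0%N - (a 1%N + b 1%N)) *
      stick (S - x) (a \o succn) (b \o succn) t'
    else 0
  else S `^ (b 0%N - 1).

Lemma stick_ge0 S a b t : 0 <= stick S a b t.
Proof.
elim: t S a b => [|x t ih] S a b /=; first exact: powR_ge0.
by case: ifP => // _; rewrite !mulr_ge0 ?powR_ge0.
Qed.

(** Joint measurability in the size and the tuple is what the induction needs: the recursive call
    has size [S - x], which depends on the point. *)
Lemma measurable_stick n a b :
  measurable_fun [set: R * n.-tuple R] (fun q => stick q.1 a b q.2).
Proof.
elim: n a b => [|n ih] a b.
  rewrite (_ : (fun _ => _) = (fun q : R * 0.-tuple R => q.1 `^ (b 0%N - 1))).
    exact: (measurableT_comp (measurable_powR _)).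
  by apply/funext => -[S t]/=; rewrite (tuple0 t).
rewrite (_ : (fun _ => _) = (fun q : R * n.+1.-tuple R =>
    if 0 < thead q.2 < q.1 then
      thead q.2 `^ (a 1%N - 1) * q.1 `^ (b 0%N - (a 1%N + b 1%N)) *
      stick (q.1 - thead q.2) (a \o succn) (b \o succn) [tuple of behead q.2]
    else 0)); last first.
  by apply/funext => -[S t]/=; rewrite {1}(tuple_eta t).
have mh : measurable_fun [set: R * n.+1.-tuple R] (fun q => thead q.2).
  by apply: (@measurableT_comp _ _ _ _ _ _ (@tnth _ R ^~ ord0)) => //;
    exact: measurable_tnth.
apply: measurable_fun_ifT.
- by apply: measurable_and; exact: measurable_fun_ltr.
- apply: measurable_funM; first apply: measurable_funM.
  + exact: (measurableT_comp (measurable_powR _)).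
  + exact: (measurableT_comp (measurable_powR _)).
  + apply: (measurableT_comp (ih _ _)
      (_ : measurable_fun _ (fun q : R * n.+1.-tuple R =>
        (q.1 - thead q.2, [tuple of behead q.2])))).
    apply/measurable_fun_pairP; split; first exact: measurable_funB.
    apply: (@measurableT_comp _ _ _ _ _ _
      (fun t : n.+1.-tuple R => [tuple of behead t])) => //.
    exact: measurable_behead.
- exact: measurable_cst.
Qed.

Lemma measurable_stick1 n S a b :
  measurable_fun [set: n.-tuple R] (fun t : n.-tuple R => stick S a b t).
Proof.
exact: (measurable_fun_pair2 S (@measurable_stick n a b)).
Qed.

(** By uniqueness of Lebesgue measure it is enough to compare the two measures on half-open
    intervals, where scaling acts on the endpoints. *)
Lemma lebesgue_measure_scale S (A : set R) : 0 < S -> measurable A ->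
  leb A = (S%:E * leb ((fun x => (S * x)%R) @^-1` A))%E.
Proof.
move=> S0 mA.
pose phi (x : measurableTypeR R) : measurableTypeR R := S * x.
have mphi : measurable_fun setT phi by exact: measurable_funM.
pose phiM : {mfun measurableTypeR R >-> measurableTypeR R} :=
  HB.pack phi (isMeasurableFun.Build _ _ _ _ phi mphi).
rewrite (@lebesgue_measure_unique R
  (mscale (NngNum (ltW S0)) (pushforward leb phiM)))//= => _ [[c e] _ <-].
have -> : mscale (NngNum (ltW S0)) (pushforward leb phiM) `]c, e]%classic =
    (S%:E * leb `](c / S)%R, (e / S)%R]%classic)%E.
  suff <- : phi @^-1` `]c, e]%classic = `](c / S)%R, (e / S)%R]%classic by [].
  apply/seteqP; split => x /=; rewrite !in_itv/= /phi;
    by rewrite ltr_pdivrMr// ler_pdivlMr// mulrC.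
rewrite !lebesgue_measure_itv/= !lte_fin ltr_pM2r ?invr_gt0//.
case: ifPn => _; last by rewrite mule0.
by rewrite -!EFinB -EFinM -mulrBl mulrCA divff ?mulr1 ?gt_eqF.
Qed.

Lemma integral_scale S (f : R -> \bar R) : 0 < S ->
  measurable_fun [set: R] f -> (forall x, (0 <= f x)%E) ->
  (\int[leb]_x f x = S%:E * \int[leb]_x f (S * x)%R)%E.
Proof.
move=> S0 mf f0.
pose phi (x : measurableTypeR R) : measurableTypeR R := S * x.
have mphi : measurable_fun setT phi by exact: measurable_funM.
pose phiM : {mfun measurableTypeR R >-> measurableTypeR R} :=
  HB.pack phi (isMeasurableFun.Build _ _ _ _ phi mphi).
rewrite (@eq_measure_integral _ _ _ setT
  (mscale (NngNum (ltW S0)) (pushforward leb phiM))); last first.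
  by move=> A mA _; exact: lebesgue_measure_scale.
rewrite ge0_integral_mscale//; congr (_ * _)%E.
by rewrite ge0_integral_pushforward.
Qed.

(** The Beta integral with values in the extended reals: it makes sense for all real parameters, in
    particular for a shifted [b - l] of either sign, where it may be infinite. *)
Definition betaE (a b : R) : \bar R :=
  (\int[leb]_(x in `]0%R, 1%R[) (x `^ (a - 1) * (1 - x) `^ (b - 1))%:E)%E.

Lemma betaE_ge0 (a b : R) : (0 <= betaE a b)%E.
Proof. by apply: integral_ge0 => x _; rewrite lee_fin mulr_ge0 ?powR_ge0. Qed.

Lemma measurable_powRM (S a b : R) (D : set R) :
  measurable_fun D (fun x => (x `^ a * (S - x) `^ b)%:E).
Proof.
apply: measurable_funS (subsetT _) _ => //; apply/measurable_EFinP.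
apply: measurable_funM; first exact: measurable_powR.
by apply: (measurableT_comp (measurable_powR _)); exact: measurable_funB.
Qed.

Lemma beta_integral_scale S (a b : R) : 0 < S ->
  (\int[leb]_(x in `]0%R, S[) (x `^ (a - 1) * (S - x) `^ (b - 1))%:E =
   (S `^ (a + b - 1))%:E * betaE a b)%E.
Proof.
move=> S0; rewrite integral_mkcond (integral_scale S0); last 2 first.
- by apply/(measurable_restrictT _ _).1 => //; exact: measurable_powRM.
- by move=> x; apply: erestrict_ge0 => y _; rewrite lee_fin mulr_ge0 ?powR_ge0.
rewrite /betaE [in RHS]integral_mkcond.
(* One factor [S] is the Jacobian of x = S y; the rest comes from the two powers of the
   integrand. *)
rewrite (_ : S `^ (a + b - 1) = S * S `^ (a + b - 2)); last first.
  rewrite -[X in X * _]powRr1 ?(ltW S0)// -powRD ?(gt_eqF S0) ?implybT//.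
  by congr (_ `^ _); lra.
rewrite EFinM -muleA; congr (_ * _)%E.
rewrite -ge0_integralZl_EFin ?powR_ge0//; last 2 first.
- by move=> x _; apply: erestrict_ge0 => y _; rewrite lee_fin mulr_ge0 ?powR_ge0.
- by apply/(measurable_restrictT _ _).1 => //; exact: measurable_powRM.
apply: eq_integral => x _; rewrite !patchE !mem_setE !in_itv/=.
rewrite pmulr_rgt0// (_ : (S * x < S) = (x < 1)); last first.
  by rewrite -[X in _ < X]mulr1 ltr_pM2l.
case: ifPn => [/andP[x0 x1]|]; last by rewrite mule0.
have -> : S - S * x = S * (1 - x) by rewrite mulrBr mulr1.
rewrite -EFinM !powRM ?subr_ge0 ?ltW//.
rewrite mulrACA -powRD ?(gt_eqF S0) ?implybT//; congr (_ `^ _ * _)%:E.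
lra.
Qed.

(** Given the first coordinate x, the others integrate to (S - x)^(b_1 - 1) times their Beta
    integrals. The remaining Beta integral of size S yields S^(a_1 + b_1 - 1), which the factor
    S^(b_0 - (a_1 + b_1)) turns into S^(b_0 - 1). *)
Lemma stick_mass n S a b : 0 < S ->
  (\int[tuple_measure leb n]_t (stick S a b t)%:E =
   (S `^ (b 0%N - 1))%:E * \prod_(i < n) betaE (a i.+1) (b i.+1))%E.
Proof.
elim: n S a b => [|n ih] S a b S0.
  rewrite big_ord0 mule1 /= integral_dirac//; last first.
    by apply/measurable_EFinP; exact: measurable_stick1.
  by rewrite diracT mul1e.
rewrite integral_tuple_cons; last 2 first.
- by apply/measurable_EFinP; exact: measurable_stick1.
- by move=> t; rewrite lee_fin stick_ge0.
rewrite big_ord_recl/=.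
pose B := (\prod_(i < n) betaE (a (lift ord0 i).+1) (b (lift ord0 i).+1))%E.
have B0 : (0 <= B)%E by apply: prode_ge0 => i _; exact: betaE_ge0.
transitivity (\int[leb]_x
   ((((fun x => (x `^ (a 1%N - 1) * (S - x) `^ (b 1%N - 1))%:E) \_ `]0%R, S[) x
    * ((S `^ (b 0%N - (a 1%N + b 1%N)))%:E * B))))%E.
  apply: eq_integral => x _; rewrite patchE mem_setE in_itv/=.
  case: ifPn => [/andP[x0 xS]|_]; last by rewrite mul0e integral0.
  under eq_integral do rewrite EFinM.
  rewrite ge0_integralZl_EFin ?mulr_ge0 ?powR_ge0//; last 2 first.
  - by move=> t _; rewrite lee_fin stick_ge0.
  - by apply/measurable_EFinP; exact: measurable_stick1.
  rewrite ih ?subr_gt0//= -/B !muleA; congr (_ * _)%E.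
  by rewrite -!EFinM mulrAC.
rewrite ge0_integralZr//; last 3 first.
- by apply/(measurable_restrictT _ _).1 => //; exact: measurable_powRM.
- by move=> x _; apply: erestrict_ge0 => y _; rewrite lee_fin mulr_ge0 ?powR_ge0.
- by rewrite mule_ge0// lee_fin powR_ge0.
rewrite -integral_mkcond beta_integral_scale// muleACA -EFinM.
rewrite -powRD ?(gt_eqF S0) ?implybT//.
by congr ((_ `^ _)%:E * _)%E; lra.
Qed.

End stick_breaking.

(** * Tail and box estimates for the stick-breaking density *)

Section tilting_and_boxes.
Context {R : realType}.
Local Notation leb := (@lebesgue_measure R).
Implicit Types (S : R) (a b u v : nat -> R) (t : seq R).

Lemma sum_tuple_cons n (x : R) (t : n.-tuple R) :
  \sum_(i < n.+1) tnth [tuple of x :: t] i = x + \sum_(i < n) tnth t i.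
Proof.
rewrite big_ord_recl tnth0; congr (_ + _).
by apply: eq_bigr => i _; rewrite tnthS.
Qed.

Lemma sum_cons_lt n (x : R) (t : n.-tuple R) (j : 'I_n) :
  \sum_(i < n.+1 | (i < (lift ord0 j))%N) tnth [tuple of x :: t] i =
  x + \sum_(i < n | (i < j)%N) tnth t i.
Proof.
rewrite big_mkcond big_ord_recl/= tnth0; congr (_ + _).
by rewrite [RHS]big_mkcond; apply: eq_bigr => i _; rewrite tnthS.
Qed.

(** Links the recursion to the closed product: once x is removed, each remainder S - x - ... is a
    remainder for the size S - x. *)
Lemma stickE n S a b (t : n.-tuple R) :
  (forall i, 0 < tnth t i) -> \sum_(i < n) tnth t i < S ->
  stick S a b t = (S - \sum_(i < n) tnth t i) `^ (b n - 1) *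
    \prod_(j < n) (tnth t j `^ (a j.+1 - 1) *
      (S - \sum_(i < n | (i < j)%N) tnth t i) `^ (b j - (a j.+1 + b j.+1))).
Proof.
elim: n S a b t => [|n ih] S a b t t0 tS.
  by rewrite (tuple0 t) !big_ord0 subr0 mulr1.
move: t0 tS; case/tupleP: t => x t t0; rewrite sum_tuple_cons => xtS.
have x0 := t0 ord0; rewrite tnth0 in x0.
have {}t0 i : 0 < tnth t i by have := t0 (lift ord0 i); rewrite tnthS.
have s0 : 0 <= \sum_(i < n) tnth t i by apply: sumr_ge0 => i _; exact: ltW.
rewrite /= x0 (_ : x < S) /=; last by rewrite (le_lt_trans _ xtS)// lerDl.
rewrite ih//; last by rewrite ltrBrDl.
have E0 : \sum_(i < n.+1 | (i < @ord0 n)%N) tnth [tuple of x :: t] i = 0.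
  by rewrite big_pred0.
rewrite [in RHS]big_ord_recl E0 tnth0 subr0 opprD addrA.
rewrite [RHS]mulrCA; congr (_ * _).
rewrite opprD addrA; congr (_ * _).
by apply: eq_bigr => j _; rewrite sum_cons_lt tnthS (opprD x) (addrA S).
Qed.

Lemma stick_neq0 n S a b (t : n.-tuple R) : 0 < S -> stick S a b t != 0 ->
  (forall i, 0 < tnth t i) /\ \sum_(i < n) tnth t i < S.
Proof.
elim: n S a b t => [|n ih] S a b t S0.
  by rewrite big_ord0; split => // -[].
case/tupleP: t => x t; rewrite /=.
case: ifP => [/andP[x0 xS]|_]; last by rewrite eqxx.
rewrite !mulf_eq0 !negb_or => /andP[_ /ih]; rewrite subr_gt0 => /(_ xS)[t0 ts].
split=> [i|]; first by case: (unliftP ord0 i) => [j|] ->; rewrite ?tnthS ?tnth0.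
by rewrite sum_tuple_cons -ltrBrDl.
Qed.

Lemma GD_stick n a b (A : set (n.-tuple R)) : measurable A ->
  (GD n a b A = ((GD_const n a b)^-1)%:E *
     \int[tuple_measure leb n]_(t in A) (stick 1 a b t)%:E)%E.
Proof.
move=> mA; rewrite -ge0_integralZl_EFin//; last 3 first.
- by move=> t _; rewrite lee_fin stick_ge0.
- by apply/measurable_EFinP/measurable_funTS; exact: measurable_stick1.
- rewrite invr_ge0; apply: prodr_ge0 => j _.
  by rewrite !mulr_ge0 ?invr_ge0 ?Gamma_ge0.
rewrite /GD integral_mkcondr; apply: eq_integral => t _; rewrite patchE.
case: ifPn => [|]; rewrite ?inE ?notin_setE => st.
  have [t0 t1] := st.
  by rewrite -EFinM stickE// /GD_density mulrA.
have [->|/(stick_neq0 ltr01)//] := eqVneq (stick 1 a b t) 0.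
by rewrite mule0.
Qed.

Lemma stick_neq0_take k S a b t : 0 < S -> stick S a b t != 0 ->
  \sum_(x <- take k t) x < S.
Proof.
elim: t k S a b => [|x t ih] [|k] S a b S0; rewrite /= ?big_nil//.
case: ifP => [/andP[x0 xS]|_]; last by rewrite eqxx.
rewrite !mulf_eq0 !negb_or => /andP[_ /(ih k)]; rewrite subr_gt0 => /(_ xS).
by rewrite big_cons ltrBrDl.
Qed.

(** Index 0 is lowered along with 1, ..., k, so that the shift with [k.+1] becomes the shift with
    [k] after composition with [succn], as the recursion of [stick] requires. *)
Definition shift_upto k (l : R) b : nat -> R :=
  fun j => if (j <= k)%N then b j - l else b j.

(* The exponent b_(j-1) - (a_j + b_j) is unchanged for j <= k, so that only the
   power of S - x_1 - ... - x_k is affected. *)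
Lemma stick_shift k l S a b t : 0 < S -> (k <= size t)%N ->
  stick S a (shift_upto k l b) t =
  stick S a b t * (S - \sum_(x <- take k t) x) `^ (- l).
Proof.
elim: t k S a b => [|x t ih] [|k] S a b S0 //= kt.
- rewrite big_nil subr0 -powRD ?(gt_eqF S0) ?implybT//.
  by rewrite /shift_upto/=; congr (_ `^ _); lra.
- rewrite big_nil subr0; case: ifP => _; last by rewrite mul0r.
  rewrite [RHS]mulrAC; congr (_ * _); rewrite -[RHS]mulrA; congr (_ * _).
  rewrite -powRD ?(gt_eqF S0) ?implybT//.
  by rewrite /shift_upto/=; congr (_ `^ _); lra.
- case: ifP => [/andP[x0 xS]|_]; last by rewrite mul0r.
  rewrite (ih k) ?subr_gt0// big_cons mulrA; congr (_ * _ `^ _ * _ * _).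
    by rewrite /shift_upto/=; lra.
  by rewrite opprD addrA.
Qed.

Definition heavy n k r : set (n.-tuple R) :=
  [set t | r <= \sum_(x <- take k t) x].

Lemma measurable_nth n i :
  measurable_fun [set: n.-tuple R] (fun t : n.-tuple R => t`_i).
Proof.
have [ni|ni] := leqP n i.
  rewrite (_ : (fun _ => _) = cst 0)//.
  by apply/funext => t; rewrite nth_default// size_tuple.
rewrite (_ : (fun _ => _) = @tnth _ R ^~ (Ordinal ni)); first exact: measurable_tnth.
by apply/funext => t; rewrite (tnth_nth 0).
Qed.

Lemma sum_take n k (t : n.-tuple R) : (k <= n)%N ->
  \sum_(x <- take k t) x = \sum_(i < k) t`_i.
Proof.
move=> kn; rewrite (big_nth 0) size_takel ?size_tuple// big_mkord.
by apply: eq_bigr => i _; rewrite nth_take.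
Qed.

Lemma measurable_sum_nth n k (f : nat -> R -> R) :
  (forall i, measurable_fun setT (f i)) ->
  measurable_fun [set: n.-tuple R] (fun t : n.-tuple R => \sum_(i < k) f i t`_i).
Proof.
move=> mf; apply: measurable_sum => i.
exact: (measurableT_comp (mf i) (@measurable_nth n i)).
Qed.

Lemma measurable_ge_set d (T : measurableType d) (f : T -> R) r :
  measurable_fun setT f -> measurable [set t | r <= f t].
Proof.
move=> mf; rewrite (_ : [set _ | _] = f @^-1` `[r, +oo[%classic).
  by rewrite -[X in measurable X]setTI; exact: mf.
by apply/seteqP; split=> t /=; rewrite in_itv/= andbT.
Qed.

Lemma measurable_heavy n k r : (k <= n)%N -> measurable (@heavy n k r).
Proof.
move=> kn; apply: measurable_ge_set.
under eq_fun do rewrite sum_take//.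
exact: (@measurable_sum_nth n k (fun=> id)).
Qed.

Lemma prod_beta_shift n k l a b : (k <= n)%N ->
  (\prod_(0 <= i < n) betaE (a i.+1) (shift_upto k l b i.+1) =
  (\prod_(0 <= i < k) betaE (a i.+1) (b i.+1 - l)) *
  \prod_(k <= i < n) betaE (a i.+1) (b i.+1))%E.
Proof.
move=> kn; rewrite (big_cat_nat (leq0n k) kn); apply: congr2.
  by apply: eq_big_nat => i /andP[_ ik]; rewrite /shift_upto ik.
by apply: eq_big_nat => i /andP[ik _]; rewrite /shift_upto ltnNge ik.
Qed.

(** Exponential Chebyshev: on [heavy] the remainder 1 - x_1 - ... - x_k is at most 1 - r, so (1 -
    r)^l times its power -l is at least 1, and that power is absorbed into the density by
    [stick_shift]. *)
Lemma stick_heavy n k r l a b : (k <= n)%N -> r < 1 -> 0 <= l ->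
  (\int[tuple_measure leb n]_(t in @heavy n k r) (stick 1 a b t)%:E <=
   ((1 - r) `^ l)%:E *
   ((\prod_(0 <= i < k) betaE (a i.+1) (b i.+1 - l)) *
    \prod_(k <= i < n) betaE (a i.+1) (b i.+1)))%E.
Proof.
move=> kn r1 l0; rewrite -prod_beta_shift// big_mkord.
have -> : (\prod_(i < n) betaE (a i.+1) (shift_upto k l b i.+1) =
  \int[tuple_measure leb n]_t (stick 1 a (shift_upto k l b) t)%:E)%E.
  by rewrite stick_mass// powR1 mul1e.
rewrite -ge0_integralZl_EFin ?powR_ge0//; last 2 first.
- by move=> t _; rewrite lee_fin stick_ge0.
- by apply/measurable_EFinP; exact: measurable_stick1.
rewrite [X in (X <= _)%E]integral_mkcond; apply: ge0_le_integral => //.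
- by move=> t _; apply: erestrict_ge0 => s _; rewrite lee_fin stick_ge0.
- apply/(measurable_restrictT _ _).1; first exact: measurable_heavy.
  by apply/measurable_funTS/measurable_EFinP; exact: measurable_stick1.
- apply/measurable_EFinP/measurable_funM => //; exact: measurable_stick1.
move=> t _; rewrite patchE; case: ifPn => [|_]; last first.
  by rewrite -EFinM lee_fin mulr_ge0 ?powR_ge0 ?stick_ge0.
rewrite inE /heavy/= => rt; rewrite -EFinM lee_fin.
have [->|st0] := eqVneq (stick 1 a b t) 0.
  by rewrite mulr_ge0 ?powR_ge0 ?stick_ge0.
have s1 := stick_neq0_take k ltr01 st0.
rewrite stick_shift ?size_tuple// mulrCA -{1}(mulr1 (stick _ _ _ _)).
rewrite ler_wpM2l ?stick_ge0// powRN ler_pdivlMr ?powR_gt0 ?subr_gt0// mul1r.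
by apply: ge0_ler_powR => //; rewrite ?nnegrE ?subr_ge0 ?lerD2l ?lerN2// ltW.
Qed.

(** A boolean test over [iota], so that the condition on the first coordinate splits off in step
    with the recursion of [stick]. *)
Definition inbox k u v t := all (fun i => u i <= t`_i <= v i) (iota 0 k).

Lemma inbox_cons k u v x t : inbox k.+1 u v (x :: t) =
  (u 0%N <= x <= v 0%N) && inbox k (u \o succn) (v \o succn) t.
Proof. by rewrite /inbox /= -[1%N]addn0 iotaDl all_map. Qed.

Lemma measurable_inbox n k u v :
  measurable_fun [set: n.-tuple R] (fun t : n.-tuple R => inbox k u v t).
Proof.
rewrite /inbox; elim: (iota 0 k) => [|i s ih] /=; first exact: measurable_cst.
apply: measurable_and => //; apply: measurable_and;
  by apply: measurable_fun_ler => //; exact: measurable_nth.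
Qed.

Lemma measurable_stick_inbox n k S a b u v :
  measurable_fun [set: n.-tuple R]
    (fun t : n.-tuple R => (if inbox k u v t then stick S a b t else 0)%:E).
Proof.
apply/measurable_EFinP; apply: measurable_fun_ifT => //.
  exact: measurable_inbox.
exact: measurable_stick1.
Qed.

(* The power S^(b_0 - 1 - be) is what makes the induction on k go through: the
   integral over the first coordinate x only uses
   (S - x)^(b_1 - 1 - be) >= S^(b_1 - 1 - be). *)
Lemma stick_inbox n k S s be a b u v (c : nat -> R) : (k <= n)%N ->
  0 < s -> S <= 1 -> s + \sum_(0 <= i < k) v i <= S ->
  (forall i, (i < k)%N -> 0 < u i < v i) ->
  (forall i, (i < k)%N -> 0 <= a i.+1 /\ b i.+1 <= be) ->
  (forall i x, (i < k)%N -> u i <= x <= v i -> 0 <= c i <= x `^ (a i.+1 - 1)) ->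
  0 <= be ->
  ((S `^ (b 0%N - 1 - be) * s `^ be * \prod_(0 <= i < k) (c i * (v i - u i)))%:E *
    \prod_(k <= i < n) betaE (a i.+1) (b i.+1) <=
   \int[tuple_measure leb n]_t (if inbox k u v t then stick S a b t else 0)%:E)%E.
Proof.
move=> + s0 + + + + + be0.
elim: k n S a b u v c => [|k ih] n S a b u v c kn S1 svS uv ab hc.
  rewrite big_geq// addr0 in svS.
  rewrite /inbox /= stick_mass ?(lt_le_trans s0)// big_geq// mulr1.
  rewrite -(big_mkord xpredT (fun i => betaE (a i.+1) (b i.+1))).
  apply: lee_wpmul2r; first by apply: prode_ge0 => i _; exact: betaE_ge0.
  have S0 : 0 < S by exact: lt_le_trans svS.
  (* With no coordinate left, s <= S, and the quotient s^be / S^be is at most 1. *)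
  rewrite lee_fin powRB ?(gt_eqF S0) ?implybT// -mulrA ger_pMr ?powR_gt0//.
  rewrite mulrC ler_pdivrMr ?powR_gt0// mul1r.
  by apply: ge0_ler_powR => //; rewrite ?nnegrE ltW.
case: n kn => // n kn.
rewrite integral_tuple_cons; last 2 first.
- exact: measurable_stick_inbox.
- by move=> t; rewrite lee_fin; case: ifP => // _; exact: stick_ge0.
set Bs := (\prod_(k.+1 <= i < n.+1) betaE (a i.+1) (b i.+1))%E.
have Bs0 : (0 <= Bs)%E by apply: prode_ge0 => i _; exact: betaE_ge0.
have svS' : v 0%N + (s + \sum_(0 <= i < k) v i.+1) <= S.
  by rewrite addrCA; move: svS; rewrite big_nat_recl.
have v0 i : (i < k.+1)%N -> 0 < v i.
  by move=> /uv /andP[ui uvi]; exact: lt_trans uvi.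
have sv0 : 0 <= \sum_(0 <= i < k) v i.+1.
  by rewrite big_nat; apply: sumr_ge0 => i /andP[_ ik]; rewrite ltW// v0.
have vS : v 0%N < S by lra.
have S0 : 0 < S by rewrite (lt_trans _ vS)// v0.
have [u0 u0v0] := andP (uv 0%N isT).
have [a0 b0] := ab 0%N isT.
(* A lower bound, up to the Beta factors [Bs], for the inner integral that is uniform in x over
   [u_0, v_0]; integrating it gives the missing length v_0 - u_0. *)
pose C := c 0%N * S `^ (b 0%N - 1 - be) * s `^ be *
  \prod_(0 <= i < k) (c i.+1 * (v i.+1 - u i.+1)).
have c0 i : (i < k.+1)%N -> 0 <= c i.
  move=> ik; have /andP[_ /ltW uiv] := uv i ik.
  by have /andP[] := hc i (u i) ik (introT andP (conj (lexx _) uiv)).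
have prod0 : 0 <= \prod_(0 <= i < k) (c i.+1 * (v i.+1 - u i.+1)).
  rewrite big_nat; apply: prodr_ge0 => i /andP[_ ik].
  by rewrite mulr_ge0 ?c0// subr_ge0 ltW//; case/andP: (uv i.+1 ik).
have C0 : 0 <= C by rewrite !mulr_ge0 ?powR_ge0 ?c0.
apply: (@le_trans _ _ (\int[leb]_(x in `[u 0%N, v 0%N]) (C%:E * Bs))%E).
  rewrite integral_cst//= lebesgue_measure_itv/= lte_fin u0v0 -EFinD.
  rewrite muleAC -EFinM le_eqVlt; apply/orP; left; apply/eqP; congr (_%:E * _)%E.
  rewrite big_nat_recl//= /C; ring.
rewrite [X in (X <= _)%E]integral_mkcond; apply: ge0_le_integral => //.
- by move=> x _; apply: erestrict_ge0 => y _; rewrite mule_ge0.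
- by apply/(measurable_restrictT _ _).1 => //; exact: measurable_cst.
- apply: (@measurable_fun_fubini_tonelli_F _ _ _ _ _ (tuple_measure leb n)
    (fun q : R * n.-tuple R => (if inbox k.+1 u v (tuple_cons q) then
      stick S a b (tuple_cons q) else 0)%:E)).
  + exact: (@measurableT_comp _ _ _ _ _ _
      (fun t : n.+1.-tuple R => (if inbox k.+1 u v t then stick S a b t else 0)%:E)
      _ _ (measurable_stick_inbox _ _ _ _ _ _) (@measurable_tuple_cons _ R n)).
  + by move=> q; rewrite lee_fin; case: ifP => // _; exact: stick_ge0.
move=> x _; rewrite patchE; case: ifPn => [|_]; last first.
  by apply: integral_ge0 => t _; rewrite lee_fin; case: ifP => // _; exact: stick_ge0.
rewrite inE /= in_itv/= => xuv; have /andP[ux xv] := xuv.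
have x0 : 0 < x by exact: lt_le_trans ux.
have xS : x < S by exact: le_lt_trans vS.
have svS1 : s + \sum_(0 <= i < k) (v \o succn) i <= S - x.
  by rewrite lerBrDl (le_trans _ svS')// lerD2r.
have E : (\int[tuple_measure leb n]_t
    (if inbox k.+1 u v (tuple_cons (x, t)) then
       stick S a b (tuple_cons (x, t)) else 0)%:E =
    (x `^ (a 1%N - 1) * S `^ (b 0%N - (a 1%N + b 1%N)))%:E *
    \int[tuple_measure leb n]_t
      (if inbox k (u \o succn) (v \o succn) t then
        stick (S - x) (a \o succn) (b \o succn) t else 0)%:E)%E.
  rewrite -ge0_integralZl_EFin ?mulr_ge0 ?powR_ge0//; last 2 first.
  - by move=> t _; rewrite lee_fin; case: ifP => // _; exact: stick_ge0.
  - exact: measurable_stick_inbox.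
  apply: eq_integral => t _; rewrite -EFinM inbox_cons/= xuv x0 xS/=.
  by case: ifP => //; rewrite mulr0.
rewrite E.
have SxS : S - x <= S by rewrite gerBl ltW.
have := ih n _ (a \o succn) (b \o succn) (u \o succn) (v \o succn) (c \o succn) kn
  (le_trans SxS S1) svS1 (fun i => uv i.+1) (fun i => ab i.+1) (fun i => hc i.+1).
move=> /(lee_wpmul2l (_ : 0 <=
  (x `^ (a 1%N - 1) * S `^ (b 0%N - (a 1%N + b 1%N)))%:E)%E).
rewrite lee_fin mulr_ge0 ?powR_ge0// => /(_ isT); apply: le_trans.
rewrite muleA -EFinM.
rewrite /Bs big_add1 /=; apply: lee_wpmul2r.
  by apply: prode_ge0 => i _; exact: betaE_ge0.
rewrite lee_fin /C !mulrA ler_wpM2r// ler_wpM2r ?powR_ge0//.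
have /andP[_ cx] := hc 0%N x isT xuv.
rewrite -mulrA; apply: ler_pM => //; rewrite ?powR_ge0 ?c0//.
have Sx0 : 0 < S - x by rewrite subr_gt0.
have e1 : (S - x) `^ (b 1%N - 1 - be) >= S `^ (b 1%N - 1 - be).
  rewrite -(opprK (b 1%N - 1 - be)) !(powRN _ (- _)) lef_pV2 ?posrE ?powR_gt0//.
  by apply: ge0_ler_powR; rewrite ?nnegrE ?ltW//; lra.
apply: le_trans (ler_wpM2l (powR_ge0 _ _) e1).
(* The exponents add up to b_0 - 1 - be - a_1; as a_1 >= 0 and S <= 1, dropping a_1 can only lower
   the power. *)
rewrite -powRD ?(gt_eqF S0) ?implybT//; apply: ger_powR; first by rewrite S0.
lra.
Qed.

End tilting_and_boxes.

(** * Bounds for the generalized Dirichlet distribution and its p-version *)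

Section dirichlet_measures.
Context {R : realType}.
Local Notation leb := (@lebesgue_measure R).
Local Notation coin := (tuple_measure (bernoulli_prob (2^-1 : R))).
Implicit Types (S : R) (a b u v : nat -> R).

(** The power is monotone in x, increasing or decreasing with the sign of [e], so its minimum on the
    interval is at an endpoint. *)
Lemma ge_min_powR (u v x e : R) : 0 < u -> u <= x <= v ->
  minr (u `^ e) (v `^ e) <= x `^ e.
Proof.
move=> u0 /andP[ux xv]; have x0 : 0 < x by exact: lt_le_trans ux.
have v0 : 0 < v by exact: lt_le_trans xv.
rewrite ge_min; have [e0|e0] := leP 0 e.
  by rewrite (ge0_ler_powR e0) ?nnegrE// ltW.
apply/orP; right; rewrite -(opprK e) !(powRN _ (- e)).
rewrite lef_pV2 ?posrE ?powR_gt0//.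
by apply: ge0_ler_powR; rewrite ?nnegrE ?oppr_ge0// ltW.
Qed.

(** Restrict the integral to [u, v], where (1 - x)^(b - 1) >= (1 - x)^b >= (1 - v)^b. Passing to the
    exponent [b] makes the bound valid for b < 1 too. *)
Lemma betaE_ge (a b u v : R) : 0 < u -> u < v -> v < 1 -> 0 <= b ->
  ((minr (u `^ (a - 1)) (v `^ (a - 1)) * (v - u) * (1 - v) `^ b)%:E <=
    betaE a b :> \bar R)%E.
Proof.
move=> u0 uv v1 b0; rewrite /betaE.
set m := minr _ _.
have m0 : 0 <= m by rewrite le_min !powR_ge0.
apply: (@le_trans _ _ (\int[leb]_(x in `[u, v]) (m * (1 - v) `^ b)%:E)%E).
  rewrite integral_cst//= lebesgue_measure_itv/= lte_fin uv -EFinD -EFinM.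
  by rewrite mulrAC.
apply: (@le_trans _ _ (\int[leb]_(x in `[u, v])
    (x `^ (a - 1) * (1 - x) `^ (b - 1))%:E)%E).
  apply: ge0_le_integral => //.
  - by move=> x _; rewrite lee_fin mulr_ge0 ?powR_ge0.
  - exact: measurable_powRM.
  move=> x; rewrite /= in_itv/= => uxv; have /andP[ux xv] := uxv.
  rewrite lee_fin; apply: ler_pM => //; rewrite ?powR_ge0//.
    exact: ge_min_powR.
  have x1 : 0 < 1 - x by lra.
  apply: (@le_trans _ _ ((1 - x) `^ b)).
    by apply: ge0_ler_powR => //; rewrite ?nnegrE; lra.
  by apply: ger_powR; lra.
apply: ge0_subset_integral => //.
- exact: measurable_powRM.
- by move=> x _; rewrite lee_fin mulr_ge0 ?powR_ge0.
- by move=> x; rewrite /= !in_itv/=; lra.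
Qed.

Lemma betaE_anti (a b b' : R) : b <= b' -> (betaE a b' <= betaE a b :> \bar R)%E.
Proof.
move=> bb'; apply: ge0_le_integral => //.
- by move=> x _; rewrite lee_fin mulr_ge0 ?powR_ge0.
- exact: measurable_powRM.
- exact: measurable_powRM.
move=> x; rewrite /= in_itv/= => x01; rewrite lee_fin ler_wpM2l ?powR_ge0//.
by apply: ger_powR; lra.
Qed.

Lemma lee_prod_nat (m n : nat) (f g : nat -> \bar R) :
  (forall i, (m <= i < n)%N -> (0 <= f i <= g i)%E) ->
  (\prod_(m <= i < n) f i <= \prod_(m <= i < n) g i)%E.
Proof.
move=> fg; rewrite !big_nat.
(* The induction also carries nonnegativity, without which the inequalities could not be
   multiplied. *)
apply: (@proj2 (0 <= \prod_(m <= i < n | (m <= i < n)%N) f i)%E).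
elim/big_ind2 : _ => [|x1 x2 y1 y2 [x0 x12] [y0 y12]|i /fg/andP[]//].
  by rewrite lexx lee01.
by split; [exact: mule_ge0|exact: lee_pmul].
Qed.

Section total_mass.
Variables (n k : nat) (a b : nat -> R).
Hypothesis kn : (k <= n)%N.
Local Notation c := ((GD_const n a b)^-1)%:E.
Local Notation B m1 m2 := (\prod_(m1 <= i < m2) betaE (a i.+1) (b i.+1))%E.
Hypothesis mass1 : GD n a b setT = 1%E.

Let c0 : (0 <= c)%E.
Proof.
rewrite lee_fin invr_ge0; apply: prodr_ge0 => j _.
by rewrite !mulr_ge0 ?invr_ge0 ?Gamma_ge0.
Qed.

Let B0 m1 m2 : (0 <= B m1 m2)%E.
Proof. by apply: prode_ge0 => i _; exact: betaE_ge0. Qed.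

Let cB : (c * (B 0 k * B k n) = 1)%E.
Proof.
rewrite -(big_cat_nat (leq0n k) kn) big_mkord -[RHS]mass1 GD_stick//.
by rewrite stick_mass// powR1 mul1e.
Qed.

(** The tail factors B_(k+1), ..., B_n cancel through the unit total mass [cB]. The denominator
    [B 0 k] is kept on the left, so that no division occurs in the extended reals. *)
Lemma GD_heavy r l : r < 1 -> 0 <= l ->
  (GD n a b (@heavy R n k r) * B 0 k <=
   ((1 - r) `^ l)%:E * \prod_(0 <= i < k) betaE (a i.+1) (b i.+1 - l))%E.
Proof.
move=> r1 l0; rewrite GD_stick; last exact: measurable_heavy.
have := stick_heavy a b kn r1 l0.
move=> /(lee_wpmul2l c0) /(lee_wpmul2r (B0 0 k)) /le_trans; apply.
rewrite (_ : (c * _ * _ = ((1 - r) `^ l)%:E *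
    \prod_(0 <= i < k) betaE (a i.+1) (b i.+1 - l) * (c * (B 0 k * B k n)))%E).
  by rewrite cB mule1.
rewrite (muleCA c) -!muleA; congr (_ * _)%E.
by rewrite muleCA; congr (_ * (_ * _))%E; rewrite muleC.
Qed.

Lemma GD_inbox s be u v (d : nat -> R) :
  0 < s -> s + \sum_(0 <= i < k) v i <= 1 ->
  (forall i, (i < k)%N -> 0 < u i < v i) ->
  (forall i, (i < k)%N -> 0 <= a i.+1 /\ b i.+1 <= be) ->
  (forall i x, (i < k)%N -> u i <= x <= v i -> 0 <= d i <= x `^ (a i.+1 - 1)) ->
  0 <= be ->
  ((s `^ be * \prod_(0 <= i < k) (d i * (v i - u i)))%:E <=
   GD n a b [set t | inbox k u v t] * B 0 k)%E.
Proof.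
move=> s0 sv uv ab hd be0.
have mbox : measurable [set t : n.-tuple R | inbox k u v t].
  by rewrite -[X in measurable X]setTI;
    exact: (@measurable_inbox _ n k u v measurableT [set true]).
rewrite GD_stick//.
have := stick_inbox kn s0 (lexx 1) sv uv ab hd be0.
rewrite powR1 mul1r => /(lee_wpmul2l c0) /(lee_wpmul2r (B0 0 k)).
rewrite [X in (X <= _)%E -> _](_ : _ = ((s `^ be *
    \prod_(0 <= i < k) (d i * (v i - u i)))%:E * (c * (B 0 k * B k n)))%E).
  rewrite cB mule1 => /le_trans; apply.
  rewrite [X in (_ <= _ * X * _)%E]integral_mkcond.
  apply: lee_wpmul2r => //; apply: lee_wpmul2l => //; apply: ge0_le_integral => //.
  - by move=> t _; rewrite lee_fin; case: ifP => // _; exact: stick_ge0.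
  - exact: measurable_stick_inbox.
  - apply/(measurable_restrictT _ _).1 => //.
    by apply/measurable_funTS/measurable_EFinP; exact: measurable_stick1.
  - move=> t _; rewrite patchE; case: ifPn => tb; first by rewrite mem_set.
    by rewrite memNset//; exact/negP.
by rewrite (muleCA c) -!muleA; congr (_ * (_ * _))%E; rewrite muleC.
Qed.

End total_mass.

(** * From the Dirichlet vector to signed p-th roots *)

Definition sign_root n (p : R) (q : n.-tuple R * n.-tuple bool) : n.-tuple R :=
  [tuple (-1) ^+ tnth q.2 i * tnth q.1 i `^ p^-1 | i < n].

Lemma measurable_sign_root n p : measurable_fun setT (@sign_root n p).
Proof.
apply/measurable_fun_tnthP => i.
rewrite (_ : _ \o _ = fun q : n.-tuple R * n.-tuple bool =>
  (-1) ^+ tnth q.2 i * tnth q.1 i `^ p^-1); last first.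
  by apply/funext => q /=; rewrite tnth_mktuple.
apply: measurable_funM.
  rewrite (_ : (fun _ => _) = fun q : n.-tuple R * n.-tuple bool =>
      if tnth q.2 i then -1 else 1); last first.
    by apply/funext => q; case: (tnth _ _); rewrite ?expr1 ?expr0.
  apply: measurable_fun_ifT => //.
  exact: (@measurableT_comp _ _ _ _ _ _ (@tnth _ bool ^~ i) _ _
    (@measurable_tnth _ _ _ i) measurable_snd).
apply: (measurableT_comp (measurable_powR _)).
exact: (@measurableT_comp _ _ _ _ _ _ (@tnth _ R ^~ i) _ _
  (@measurable_tnth _ _ _ i) measurable_fst).
Qed.

Lemma coinT n : coin n setT = 1%E.
Proof.
have := @tuple_measure_box _ _ _ (bernoulli_prob (2^-1 : R)) n
  (fun=> setT) (fun=> measurableT).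
rewrite big1 => [<-|i _]; last exact: probability_setT.
by congr (coin n _); apply/seteqP; split.
Qed.

Section pGD.
Variables (n : nat) (p : R) (a b : nat -> R).

Lemma measurable_sign_root_preimage A : measurable A ->
  measurable (@sign_root n p @^-1` A).
Proof.
by move=> mA; rewrite -[X in measurable X]setTI; exact: measurable_sign_root.
Qed.

Lemma pGD_setT : pGD n p a b setT = GD n a b setT.
Proof.
rewrite /pGD /pushforward preimage_setT -setXTT product_measure1E//.
by rewrite coinT mule1.
Qed.

(* Off the simplex the root of a negative number is junk, hence the restriction;
   GD does not charge the complement. *)
Lemma pGD_le A C : measurable A -> measurable C ->
  (forall q, open_simplex n q.1 -> A (sign_root p q) -> C q.1) ->
  (pGD n p a b A <= GD n a b C)%E.
Proof.
move=> mA mC AC.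
pose C' := C `|` ~` open_simplex n.
have mC' : measurable C'.
  by apply: measurableU => //; apply: measurableC; exact: measurable_open_simplex.
have -> : GD n a b C = GD n a b C'.
  by rewrite /GD /C' setIUl setICl setU0.
rewrite -[leRHS]mule1 -(coinT n) -product_measure1E//.
rewrite /pGD /pushforward.
apply: (@le_measure _ _ _ (GD n a b \x coin n)%E); rewrite ?inE.
- exact: measurable_sign_root_preimage.
- exact: measurableX.
move=> q /= Aq; split => //=; have [sq|] := pselect (open_simplex n q.1).
  by left; exact: AC Aq.
by right.
Qed.

Lemma pGD_ge A C E : measurable A -> measurable C -> measurable E ->
  (forall q, C q.1 -> E q.2 -> A (sign_root p q)) ->
  (GD n a b C * coin n E <= pGD n p a b A)%E.
Proof.
move=> mA mC mE AC; rewrite -product_measure1E//.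
rewrite /pGD /pushforward.
apply: (@le_measure _ _ _ (GD n a b \x coin n)%E); rewrite ?inE.
- exact: measurableX.
- exact: measurable_sign_root_preimage.
by move=> q /= [Cq Eq]; exact: AC.
Qed.

End pGD.

(** Only the first k signs are prescribed, so the probability does not depend on n and is negligible
    on the exponential scale. *)
Lemma coin_prefix n k (e : nat -> bool) : (k <= n)%N ->
  coin n [set t : n.-tuple bool | forall i, (i < k)%N -> nth false t i = e i] =
  ((2^-1) ^+ k)%:E.
Proof.
move=> kn.
pose A (i : 'I_n) := if (i < k)%N then [set e i] else [set: bool].
have -> : [set t : n.-tuple bool | forall i, (i < k)%N -> nth false t i = e i] =
    [set t | forall i, A i (tnth t i)].
  apply/seteqP; split => t /= h i.
    by rewrite /A; case: ifPn => // ik; rewrite /= -h// (tnth_nth false).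
  move=> ik; have in_ := leq_trans ik kn.
  have := h (Ordinal in_); rewrite /A /= ik (tnth_nth false)/=.
  by [].
rewrite tuple_measure_box//.
rewrite (eq_bigr (fun i : 'I_n => if (i < k)%N then (2^-1)%:E else 1%E)); last first.
  move=> i _; rewrite /A; case: ifPn => _; last exact: probability_setT.
  have h : 0 <= (2^-1 : R) <= 1 by lra.
  rewrite /= [LHS](bernoulli_probE h).
  rewrite !diracE; case: (e i).
    by rewrite mem_set// memNset// mule1 mule0 adde0.
  rewrite memNset// mem_set// mule1 mule0 add0e.
  by congr EFin; apply: (_ : 1 - 2^-1 = 2^-1); lra.
rewrite -(big_mkord xpredT (fun i => if (i < k)%N then (2^-1)%:E else 1%E)).
rewrite (big_cat_nat (leq0n k) kn)/= [X in (_ * X)%E]big_nat_cond.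
rewrite [X in (_ * X)%E]big1 ?mule1; last first.
  by move=> i /andP[/andP[ki _] _]; rewrite ltnNge ki.
rewrite (@eq_big_nat _ _ _ _ _ _ (fun=> (2^-1)%:E)); last first.
  by move=> i /andP[_ ->].
by rewrite prodEFin prodr_const_nat subn0.
Qed.

End dirichlet_measures.

(** * Exponential asymptotics *)

Section limsup.
Context {R : realType}.
Implicit Types (u : (\bar R)^nat) (l : R).

(** The limsup is an infimum of suprema over the sets of the filter at infinity, and the set where
    [u N <= l + e] is one of them. *)
Lemma limn_esup_le u l :
  (forall e, 0 < e -> \forall N \near \oo, (u N <= (l + e)%:E)%E) ->
  (limn_esup u <= l%:E)%E.
Proof.
move=> ul; apply/lee_addgt0Pr => e e0; rewrite -EFinD.
apply: (@le_trans _ _ (ereal_sup (u @` [set N | (u N <= (l + e)%:E)%E]))).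
  by apply: ereal_inf_lbound; exists [set N | (u N <= (l + e)%:E)%E] => //; exact: ul.
by apply: ge_ereal_sup => _ [N uN <-].
Qed.

Lemma limn_einf_ge u l :
  (forall e, 0 < e -> \forall N \near \oo, ((l - e)%:E <= u N)%E) ->
  (l%:E <= limn_einf u)%E.
Proof.
move=> ul; rewrite /limn_einf leeNr -EFinN; apply: limn_esup_le => e e0.
by apply: filterS (ul _ e0) => N; rewrite leeNl -EFinN opprD opprK.
Qed.

Lemma scaled_lne_le (N : nat) (x : \bar R) (y : R) : (0 < N)%N ->
  (0 <= x <= (expR (N%:R * y))%:E)%E -> ((N%:R^-1)%:E * lne x <= y%:E)%E.
Proof.
move=> N0 /andP[x0 xy]; have N0' : 0 < N%:R :> R by rewrite ltr0n.
have -> : y%:E = ((N%:R^-1)%:E * (N%:R * y)%:E)%E.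
  by rewrite -EFinM mulKf// gt_eqF.
apply: lee_wpmul2l; first by rewrite lee_fin invr_ge0 ltW.
by rewrite -[leRHS](@expeRK R) lee_lne ?in_itv/= ?leey ?andbT//= lee_fin expR_ge0.
Qed.

Lemma scaled_lne_ge (N : nat) (x : \bar R) (y : R) : (0 < N)%N ->
  ((expR (N%:R * y))%:E <= x)%E -> (y%:E <= (N%:R^-1)%:E * lne x)%E.
Proof.
move=> N0 xy; have N0' : 0 < N%:R :> R by rewrite ltr0n.
have -> : y%:E = ((N%:R^-1)%:E * (N%:R * y)%:E)%E.
  by rewrite -EFinM mulKf// gt_eqF.
apply: lee_wpmul2l; first by rewrite lee_fin invr_ge0 ltW.
rewrite -[leLHS](@expeRK R) lee_lne ?in_itv/= ?leey ?andbT//= ?lee_fin ?expR_ge0//.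
by apply: le_trans xy; rewrite lee_fin expR_ge0.
Qed.

End limsup.

(** * Tails and boxes when b_1, ..., b_k grow like N / p *)

Section asymptotics.
Context {R : realType} (p : R) (k : nat) (a b : nat -> nat -> R).
Hypothesis p1 : 1 <= p.
Hypothesis ab_gt0 : forall N j, (k <= N)%N -> (1 <= j <= N)%N ->
     0 < a N j /\ 0 < b N j.
Hypothesis a_const : forall N M j, (k <= N)%N -> (k <= M)%N -> (1 <= j <= k)%N ->
     a N j = a M j.
Hypothesis b_asymp : forall j, (1 <= j <= k)%N ->
     (fun N => p * b N j : R^o) = (fun N => N%:R : R^o) +o_\oo
       (fun N => N%:R : R^o).
Hypothesis mass1 : forall N, (k <= N)%N -> GD N (a N) (b N) setT = 1%E.

Let p0 : 0 < p. Proof. exact: lt_le_trans p1. Qed.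

Local Notation Bk N := (\prod_(0 <= i < k) betaE (a N i.+1) (b N i.+1))%E.

Lemma near_b (e : R) : 0 < e -> \forall N \near \oo, forall i, (i < k)%N ->
  (1 - e) * N%:R / p <= b N i.+1 <= (1 + e) * N%:R / p.
Proof.
move=> e0.
have : \forall N \near \oo, forall i : 'I_k,
  (1 - e) * N%:R / p <= b N i.+1 <= (1 + e) * N%:R / p.
  apply: filter_forall => i.
  have /eqaddoP/(_ _ e0) := b_asymp (ltn_ord i : 1 <= i.+1 <= k)%N.
  apply: filterS => N /=; rewrite (ger0_norm (ler0n _ _)).
  rewrite -[X in `|X|]/(p * b N i.+1 - N%:R) ler_norml => h.
  rewrite ler_pdivrMr// ler_pdivlMr// (mulrC (b _ _)).
  by move: h => /andP[]; lra.
by apply: filterS => N h i ik; exact: (h (Ordinal ik)).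
Qed.

Lemma near_large (C e : R) : 0 < e -> \forall N \near \oo, C <= N%:R * e.
Proof.
move=> e0; have := nbhs_infty_ger (C / e : R).
by apply: filterS => N; rewrite ler_pdivrMr.
Qed.

(* Finiteness comes for free: the normalising constant times this product is 1. *)
Lemma Bk_fin : exists2 K : R, 0 < K & Bk k = K%:E.
Proof.
have := mass1 (leqnn k); rewrite GD_stick// stick_mass// powR1 mul1e.
rewrite -(big_mkord xpredT (fun i => betaE (a k i.+1) (b k i.+1))).
have : (0 <= Bk k)%E by apply: prode_ge0 => i _; exact: betaE_ge0.
set c := (_ ^-1); have c0 : 0 <= c.
  rewrite invr_ge0; apply: prodr_ge0 => j _.
  by rewrite !mulr_ge0 ?invr_ge0 ?Gamma_ge0.
case: (\prod_(0 <= i < k) _)%E => [K| |]//.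
- rewrite lee_fin le_eqVlt => /predU1P[<-|K0 _]; last by exists K.
  by rewrite mule0 => -[] /eqP; rewrite eq_sym oner_eq0.
- move=> _; move: c0; rewrite le_eqVlt => /predU1P[<-|c0].
    by rewrite mul0e => -[] /eqP; rewrite eq_sym oner_eq0.
  by rewrite gt0_muley.
Qed.

(** The shifted parameter is of order (1 - l) N / p, hence eventually above half of that and above
    the fixed [b k i.+1]. Beta integrals decrease in b, so those for N = k serve as a uniform
    bound. *)
Lemma near_Bk_le (K : R) (l : R) : 0 <= l < 1 -> Bk k = K%:E ->
  \forall N \near \oo, (\prod_(0 <= i < k)
     betaE (a N i.+1) (b N i.+1 - l * N%:R / p) <= K%:E)%E.
Proof.
move=> /andP[l0 l1] BK.
have e0 : 0 < (1 - l) / 2 by rewrite divr_gt0// subr_gt0.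
have : \forall N \near \oo, forall i : 'I_k, b k i.+1 <= N%:R * ((1 - l) / 2 / p).
  by apply: filter_forall => i; apply: near_large; rewrite divr_gt0.
move=> h; near=> N; rewrite -BK; apply: lee_prod_nat => i /andP[_ ik].
have kN : (k <= N)%N by near: N; exists k.
rewrite betaE_ge0/= (a_const kN (leqnn k))//; apply: betaE_anti.
have H : forall i : 'I_k, b k i.+1 <= N%:R * ((1 - l) / 2 / p) by near: N.
apply: (le_trans (H (Ordinal ik))).
have H2 : forall i, (i < k)%N -> (1 - (1 - l) / 2) * N%:R / p <= b N i.+1 <=
    (1 + (1 - l) / 2) * N%:R / p.
  by near: N; exact: near_b.
have /andP[+ _] := H2 _ ik.
by lra.
Unshelve. all: by end_near. Qed.

(* With l = (1 - 2 d) N / p, the parameters b_j - l still tend to infinity, so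
   the Beta integrals B(a_j, b_j - l) stay bounded, while restricting B(a_j, b_j)
   to [v / 2, v] with 1 - v = exp (- t) gives a lower bound of order
   exp (- t b_j), with t as small as needed. *)
Lemma near_GD_heavy (m e : R) : 0 <= m -> 0 < e -> \forall N \near \oo,
  (GD N (a N) (b N) (heavy k (1 - expR (- (p * m)))%R) <=
    (expR (N%:R * (- m + e)))%:E)%E.
Proof.
move=> m0 e0.
have [K K0 BK] := Bk_fin.
(* The error [e] is split in three: 2 d m for the loss in l, k t (1 + d) / p for the Beta integrals
   from below, and ln (K / G) / N for the constants. The bound 1/4 keeps 1 - 2 d positive. *)
pose d := minr 4^-1 (e / (6 * (m + 1))).
have d0 : 0 < d by rewrite lt_min invr_gt0 ltr0n/= divr_gt0//; lra.
have d4 : d <= 4^-1 by rewrite ge_min lexx.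
have dm : 2 * d * m <= e / 3.
  have : d * (6 * (m + 1)) <= e.
    by rewrite -ler_pdivlMr; [rewrite ge_min lexx orbT|lra].
  by nra.
pose t := e * p / (6 * (k%:R + 1)).
have k0 : 0 <= k%:R :> R by exact: ler0n.
have t0 : 0 < t by rewrite divr_gt0 ?mulr_gt0//; lra.
have tk : k%:R * t * (1 + d) / p <= e / 3.
  rewrite ler_pdivrMr// /t.
  have -> : k%:R * (e * p / (6 * (k%:R + 1))) * (1 + d) =
      (e / 3 * p) * ((k%:R / (k%:R + 1)) * ((1 + d) / 2)).
    by field; lra.
  rewrite ger_pMr ?mulr_gt0 ?divr_gt0//.
  apply: mulr_ile1; rewrite ?divr_ge0//; try lra.
  by rewrite ler_pdivrMr; lra.
pose v := 1 - expR (- t).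
have v0 : 0 < v by rewrite subr_gt0 expR_lt1; lra.
have v1 : v < 1 by rewrite ltrBlDr ltrDl expR_gt0.
pose g i := minr ((v / 2) `^ (a k i.+1 - 1)) (v `^ (a k i.+1 - 1)) * (v - v / 2).
have g0 i : 0 < g i by rewrite mulr_gt0 ?lt_min ?powR_gt0//; lra.
pose G := \prod_(0 <= i < k) g i.
have G0 : 0 < G by apply: prodr_gt0 => i _.
near=> N.
have kN : (k <= N)%N by near: N; exists k.
have H2 : forall i, (i < k)%N ->
    (1 - d) * N%:R / p <= b N i.+1 <= (1 + d) * N%:R / p.
  by near: N; exact: near_b.
have BKN : (\prod_(0 <= i < k)
    betaE (a N i.+1) (b N i.+1 - (1 - 2 * d) * N%:R / p)%R <= K%:E)%E.
  by near: N; apply: near_Bk_le => //; lra.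
have N0 : 0 <= N%:R / p :> R by rewrite divr_ge0// ltW.
pose l := (1 - 2 * d) * N%:R / p.
have l0 : 0 <= l by rewrite /l -mulrA mulr_ge0//; lra.
have r1 : 1 - expR (- (p * m)) < 1 by rewrite ltrBlDr ltrDl expR_gt0.
have := GD_heavy kN (mass1 kN) r1 l0.
rewrite subKr => hup.
have {}hup : (GD N (a N) (b N) (heavy k (1 - expR (- (p * m)))%R) * Bk N <=
    (expR (- (p * m)) `^ l * K)%:E)%E.
  apply: (le_trans hup); rewrite EFinM; apply: lee_wpmul2l.
    by rewrite lee_fin powR_ge0.
  exact: BKN.
have Bkg : ((G * expR (- t * ((1 + d) * N%:R / p) * k%:R))%:E <= Bk N)%E.
  have -> : (G * expR (- t * ((1 + d) * N%:R / p) * k%:R))%:E =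
      (\prod_(0 <= i < k) (g i * expR (- t * ((1 + d) * N%:R / p)))%:E)%E.
    rewrite prodEFin; congr EFin; rewrite big_split/= -/G; congr (_ * _).
    by rewrite expRM_natr prodr_const_nat subn0.
  apply: lee_prod_nat => i /andP[_ ik].
  rewrite lee_fin mulr_ge0 ?expR_ge0 ?(ltW (g0 i))//=.
  have iN : (1 <= i.+1 <= N)%N by exact: leq_trans kN.
  have [_ b0] := ab_gt0 kN iN.
  have v2 : 0 < v / 2 by lra.
  have v2v : v / 2 < v by lra.
  apply: le_trans (betaE_ge (a N i.+1) v2 v2v v1 (ltW b0)).
  rewrite (a_const kN (leqnn k))// -/(g i) lee_fin ler_pM2l//.
  rewrite /v subKr -expRM ler_expR; have /andP[_] := H2 _ ik.
  by nra.
have Gfin : GD N (a N) (b N) (heavy k (1 - expR (- (p * m)))%R) \is a fin_num.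
  rewrite ge0_fin_numE//; apply: (@le_lt_trans _ _ 1%E); last exact: ltry.
  rewrite -(mass1 kN); apply: le_measure; rewrite ?inE//.
  exact: measurable_heavy.
have : (0 <= GD N (a N) (b N) (heavy k (1 - expR (- (p * m)))%R))%E.
  exact: measure_ge0.
move: hup Gfin; case: (GD _ _ _ _) => // x hup _; rewrite lee_fin => x0.
have := lee_wpmul2l (_ : 0 <= x%:E)%E Bkg.
rewrite lee_fin => /(_ x0) /le_trans /(_ hup).
rewrite -EFinM !lee_fin -expRM.
have hC : ln (K / G) <= N%:R * (e / 3) by near: N; apply: near_large; lra.
have KG : 0 < K / G by rewrite divr_gt0.
rewrite -ler_pdivlMr ?mulr_gt0 ?expR_gt0// => hx.
have {}hx : x <= (K / G) * expR (- (p * m) * l + t * ((1 + d) * N%:R / p) * k%:R).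
  apply: (le_trans hx); rewrite invfM -expRN !mulNr opprK expRD.
  by rewrite le_eqVlt; apply/orP; left; apply/eqP; ring.
apply: (le_trans hx); rewrite -[K / G]lnK ?posrE// -expRD ler_expR.
have E1 : - (p * m) * l = N%:R * (- m + 2 * d * m).
  by rewrite /l; field; rewrite gt_eqF.
have E2 : t * ((1 + d) * N%:R / p) * k%:R = N%:R * (k%:R * t * (1 + d) / p).
  by field; rewrite gt_eqF.
rewrite E1 E2.
have N0' : 0 <= N%:R :> R by [].
have := ler_wpM2l N0' dm; have := ler_wpM2l N0' tk; lra.
Unshelve. all: by end_near. Qed.

Lemma near_GD_inbox (s e : R) (u v : nat -> R) :
  0 < s -> s + \sum_(0 <= i < k) v i <= 1 ->
  (forall i, (i < k)%N -> 0 < u i < v i) -> 0 < e ->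
  \forall N \near \oo, ((expR (N%:R * (p^-1 * ln s - e)))%:E <=
    GD N (a N) (b N) [set t | inbox k u v t] * ((2^-1) ^+ k)%:E)%E.
Proof.
move=> s0 sv uv e0.
have [K K0 BK] := Bk_fin.
pose g i := minr (u i `^ (a k i.+1 - 1)) (v i `^ (a k i.+1 - 1)).
have g0 i : (i < k)%N -> 0 < g i.
  move=> /uv/andP[ui uvi]; rewrite lt_min !powR_gt0//.
  exact: lt_trans uvi.
pose G := \prod_(0 <= i < k) (g i * (v i - u i)).
have G0 : 0 < G.
  rewrite /G big_nat; apply: prodr_gt0 => i /andP[_ ik].
  by rewrite mulr_gt0 ?g0// subr_gt0; case/andP : (uv i ik).
(* Replacing N / p by (1 + d) N / p in the exponent of s costs at most e / 2 per unit of N; the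
   other half pays for the constant [C]. The added 1 covers ln s = 0. *)
pose d := e * p / (2 * (`|ln s| + 1)).
have s1 : 0 < 2 * (`|ln s| + 1) by have := normr_ge0 (ln s); lra.
have d0 : 0 < d by rewrite divr_gt0 ?mulr_gt0.
have ds : - (e / 2) <= d / p * ln s.
  have : d / p * `|ln s| <= e / 2.
    have w0 := normr_ge0 (ln s); have w1 : 0 < `|ln s| + 1 by lra.
    have -> : d / p * `|ln s| = e / 2 * (`|ln s| / (`|ln s| + 1)).
      by rewrite /d; field; rewrite !gt_eqF.
    by rewrite ger_pMr ?divr_gt0// ler_pdivrMr// mul1r lerDl.
  have := ler_norm (- ln s); rewrite normrN => h1 h2.
  have dp : 0 < d / p by rewrite divr_gt0.
  by have := ler_wpM2l (ltW dp) h1; lra.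
near=> N.
have kN : (k <= N)%N by near: N; exists k.
have H2 : forall i, (i < k)%N ->
    (1 - d) * N%:R / p <= b N i.+1 <= (1 + d) * N%:R / p.
  by near: N; exact: near_b.
have N0 : 0 <= N%:R / p :> R by rewrite divr_ge0// ltW.
pose be := (1 + d) * N%:R / p.
have be0 : 0 <= be by rewrite /be -mulrA mulr_ge0//; lra.
have hab i : (i < k)%N -> 0 <= a N i.+1 /\ b N i.+1 <= be.
  move=> ik; have iN : (1 <= i.+1 <= N)%N by exact: leq_trans kN.
  have [/ltW ? _] := ab_gt0 kN iN; split => //.
  by have /andP[] := H2 i ik.
have hg i x : (i < k)%N -> u i <= x <= v i -> 0 <= g i <= x `^ (a N i.+1 - 1).
  move=> ik uxv; rewrite ltW ?g0//= (a_const kN (leqnn k))//; apply: ge_min_powR => //.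
  by have /andP[] := uv i ik.
have := GD_inbox kN (mass1 kN) s0 sv uv hab hg be0.
(* This is the uniform bound with shift l = 0. *)
have BN : (Bk N <= K%:E)%E.
  have : (\prod_(0 <= i < k)
      betaE (a N i.+1) (b N i.+1 - 0 * N%:R / p)%R <= K%:E)%E.
    by near: N; apply: near_Bk_le => //; rewrite lexx ltr01.
  by under eq_bigr do rewrite !mul0r subr0.
rewrite -/G => h.
have := le_trans h (lee_wpmul2l (measure_ge0 _ _) BN).
set x := GD _ _ _ _; rewrite muleC -lee_pdivrMl// => {}h.
have h2 : 0 <= ((2^-1 : R) ^+ k) by rewrite exprn_ge0// invr_ge0.
have h3 : (0 <= ((2^-1 : R) ^+ k)%:E)%E by rewrite lee_fin.
apply: le_trans (lee_wpmul2r h3 h).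
rewrite -!EFinM lee_fin.
pose C := K^-1 * G * (2^-1) ^+ k.
have C0 : 0 < C by rewrite !mulr_gt0 ?invr_gt0 ?exprn_gt0.
have hC : - ln C <= N%:R * (e / 2) by near: N; apply: near_large; lra.
have -> : K^-1 * (s `^ be * G) * 2^-1 ^+ k = s `^ be * C by rewrite /C; ring.
rewrite -[C]lnK ?posrE// /powR gt_eqF// -expRD ler_expR.
have E1 : be * ln s = N%:R * (p^-1 * ln s + d / p * ln s).
  by rewrite /be; field; rewrite gt_eqF.
rewrite E1.
have N0' : 0 <= N%:R :> R by [].
have := ler_wpM2l N0' ds; lra.
Unshelve. all: by end_near. Qed.

End asymptotics.

(** * The ball and its topology *)

Section geometry.
Context {R : realType}.

Definition row_of n k (t : n.-tuple R) : 'rV[R]_k := \row_(i < k) t`_i.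

(** Bridges the topology of row vectors and the product sigma-algebra of tuples: an open set is the
    union of the countably many rational boxes that it contains. *)
Lemma measurable_row_open n k (O : set 'rV[R]_k) : open O ->
  measurable [set t : n.-tuple R | O (row_of k t)].
Proof.
move=> oO.
pose box (q : {ffun 'I_k -> rat * rat}) (x : 'rV[R]_k) :=
  forall i, ratr (q i).1 < x 0 i < ratr (q i).2.
rewrite (_ : [set _ | _] = \bigcup_(q in [set q | box q `<=` O])
    [set t : n.-tuple R | box q (row_of k t)]); last first.
  apply/seteqP; split => [t /= Ot|t /= [q qO qt]]; last exact: qO.
  have : nbhs (row_of k t) O by apply: open_nbhs_nbhs.
  move=> /nbhs_ballP[e /= e0 eO].
  have lo i : {q : rat | row_of k t 0 i - e < ratr q < row_of k t 0 i}.
    apply: cid; have /rat_in_itvoo[q] : row_of k t 0 i - e < row_of k t 0 i.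
      by rewrite ltrBlDr ltrDl.
    by rewrite in_itv/=; exists q.
  have hi i : {q : rat | row_of k t 0 i < ratr q < row_of k t 0 i + e}.
    apply: cid; have /rat_in_itvoo[q] : row_of k t 0 i < row_of k t 0 i + e.
      by rewrite ltrDl.
    by rewrite in_itv/=; exists q.
  exists [ffun i => (sval (lo i), sval (hi i))] => [x bx|i]; last first.
    rewrite ffunE/=.
    by have /andP[_ ->] := svalP (lo i); have /andP[-> _] := svalP (hi i).
  apply: eO; split => // i j; rewrite (ord1 i) /ball/= ltr_distlC.
  have := bx j; rewrite ffunE/=.
  have := svalP (lo j); have := svalP (hi j); lra.
rewrite bigcup_mkcond; apply: countable_bigcupT_measurable => [|q].
  exact: countableP.
case: ifPn => // _.
rewrite (_ : [set _ | _] = \bigcap_(i in [set: 'I_k])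
  ((fun t : n.-tuple R => t`_i) @^-1` `]ratr (q i).1, ratr (q i).2[%classic)).
  apply: fin_bigcap_measurable => // i _; rewrite -[X in measurable X]setTI.
  exact: measurable_nth.
apply/seteqP; split => t /= h i; have := h i; rewrite mxE /= ?in_itv//=.
by move=> /(_ I).
Qed.

(** Away from 0 the power is differentiable; at 0 continuity follows from |y|^p <= |y| for |y| <=
    1. *)
Lemma continuous_norm_powR (p : R) : 1 <= p ->
  continuous (fun t : R => `|t| `^ p).
Proof.
move=> p1 t; have p0 : 0 < p by exact: lt_le_trans p1.
have [->|t0] := eqVneq t 0; last first.
  have n0 : 0 < `|t| by rewrite normr_gt0.
  apply: (@continuous_comp _ _ _ (fun t : R => `|t|) (fun y : R => y `^ p)).
    exact: norm_continuous.
  apply: differentiable_continuous; apply/derivable1_diffP.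
  by apply: derivable_powR; rewrite in_itv/= n0.
rewrite /continuous_at normr0 powR0 ?gt_eqF//.
apply/cvgrPdist_lt => e e0; near=> y.
rewrite sub0r normrN ger0_norm ?powR_ge0//.
have [->|y0] := eqVneq y 0; first by rewrite normr0 powR0 ?gt_eqF.
have yb : `|0 - y| < minr e 1.
  near: y; apply: (@nbhsx_ballx _ _ (0 : R) (minr e 1)).
  by rewrite lt_min e0 ltr01.
rewrite sub0r normrN lt_min in yb; have /andP[ye y1] := yb.
apply: le_lt_trans ye; apply: ge1r_powR => //.
by rewrite normr_gt0 y0 ltW.
Unshelve. all: by end_near. Qed.

(** A filter on the subtype is pushed to [V], where it clusters at a point of [K]; that point lies
    in [A] and lifts back. *)
Lemma compact_set_val (V : topologicalType) (A : set V) (K : set V) :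
  compact K -> K `<=` A -> compact (set_val @^-1` K : set A).
Proof.
move=> cK KA F PF FK.
have GK : (set_val @ F) K by [].
have [x [Kx clx]] := cK (set_val @ F) (fmap_proper_filter _ PF) GK.
exists (SigSub (mem_set (KA _ Kx)) : A); split => //.
move=> B C FB /= [_ [[U oU <-] Ux UC]].
have : F (set_val @^-1` (set_val @` B)).
  by apply: filterS FB => y By; exists y.
move=> /clx /(_ (open_nbhs_nbhs (conj oU Ux)))[_ [[y By <-] Uy]].
by exists y; split => //; exact: UC.
Qed.

Variables (p : R) (k : nat).
Hypothesis p1 : 1 <= p.
Let p0 : 0 < p. Proof. exact: lt_le_trans p1. Qed.

Lemma pnormX (x : 'rV[R]_k) : pnorm p x `^ p = \sum_(i < k) `|x 0 i| `^ p.
Proof.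
rewrite /pnorm -powRrM mulVf ?gt_eqF// powRr1//.
by apply: sumr_ge0 => i _; exact: powR_ge0.
Qed.

Lemma pball_sum_lt1 (x : 'rV[R]_k) : pball k p x ->
  \sum_(i < k) `|x 0 i| `^ p < 1.
Proof.
rewrite /pball/= => x1; rewrite -pnormX.
have := gt0_ltr_powR p0 _ _ x1; rewrite powR1; apply.
- by rewrite nnegrE powR_ge0.
- by rewrite nnegrE.
Qed.

Lemma sum_lt1_pball (x : 'rV[R]_k) : \sum_(i < k) `|x 0 i| `^ p < 1 -> pball k p x.
Proof.
move=> x1; rewrite /pball/= /pnorm.
have pV : 0 < p^-1 by rewrite invr_gt0.
have := gt0_ltr_powR pV _ _ x1; rewrite powR1; apply.
- by rewrite nnegrE; apply: sumr_ge0 => i _; exact: powR_ge0.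
- by rewrite nnegrE.
Qed.

(** Exponentiation turns a sublevel set of the rate function into one of the sum of the |x_i|^p, the
    form in which the Dirichlet bounds apply. *)
Lemma rate_le (x : 'rV[R]_k) (c : R) : pball k p x ->
  (- p^-1 * ln (1 - pnorm p x `^ p) <= c) =
  (\sum_(i < k) `|x 0 i| `^ p <= 1 - expR (- (p * c))).
Proof.
move=> /pball_sum_lt1 x1; rewrite pnormX.
rewrite mulNr lerNl -ler_pdivrMl ?invr_gt0// invrK mulrN.
by rewrite -[leLHS]expRK ler_ln ?posrE ?expR_gt0 ?subr_gt0// lerBrDl -lerBrDr.
Qed.

Lemma rate_ge (x : 'rV[R]_k) (c : R) : pball k p x ->
  (c <= - p^-1 * ln (1 - pnorm p x `^ p)) =
  (1 - expR (- (p * c)) <= \sum_(i < k) `|x 0 i| `^ p).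
Proof.
move=> /pball_sum_lt1 x1; rewrite pnormX.
rewrite mulNr lerNr -ler_pdivlMl ?invr_gt0// invrK mulrN.
by rewrite -[leRHS]expRK ler_ln ?posrE ?expR_gt0 ?subr_gt0// lerBlDl -lerBlDr.
Qed.

(** The threshold 1 - exp (- p c) is below 1, so the sublevel set is closed and bounded in the whole
    space and stays inside the open ball. *)
Lemma rate_compact (c : R) :
  compact [set x : pball k p |
    ((- p^-1 * ln (1 - pnorm p (set_val x) `^ p))%:E <= c%:E)%E].
Proof.
pose K := [set x : 'rV[R]_k | \sum_(i < k) `|x 0 i| `^ p <= 1 - expR (- (p * c))].
have Ksub : K `<=` pball k p.
  move=> x Kx; apply: sum_lt1_pball; apply: le_lt_trans Kx _.
  by rewrite ltrBlDr ltrDl expR_gt0.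
rewrite (_ : [set _ | _] = set_val @^-1` K); last first.
  apply/seteqP; split => x /=; rewrite lee_fin rate_le//; exact: set_valP.
apply: compact_set_val => //; apply: bounded_closed_compact.
  exists 1; split => // M M1 x /Ksub /pball_sum_lt1 x1.
  rewrite /normr/= mx_normrE; apply/bigmax_leP.
  split => [|[i j] _ /=]; first by rewrite ltW// (lt_trans _ M1).
  rewrite (ord1 i) leNgt; apply/negP => Mx.
  have := x1; rewrite ltNge => /negP; apply.
  rewrite (bigD1 j)//= -[leLHS]addr0.
  apply: lerD; last by apply: sumr_ge0 => l _; exact: powR_ge0.
  have x1' : 1 <= `|x 0 j| by rewrite ltW// (lt_trans M1).
  by rewrite (le_trans x1')// le1r_powR.
have ctn : continuous (fun x : 'rV[R]_k => \sum_(i < k) `|x 0 i| `^ p).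
  apply: continuous_big => [|i _].
    by move=> [x y]; apply: (@add_continuous R^o).
  move=> x; apply: (@continuous_comp _ _ _ (fun x : 'rV[R]_k => x 0 i)
    (fun t : R => `|t| `^ p)).
    exact: coord_continuous.
  exact: continuous_norm_powR.
rewrite (_ : K = (fun x : 'rV[R]_k => \sum_(i < k) `|x 0 i| `^ p) @^-1`
  [set y | y <= 1 - expR (- (p * c))])//.
by apply: closed_comp; [move=> x _; exact: ctn|exact: closed_le].
Qed.

End geometry.

(** * The large deviations principle *)

Section ldp.
Context {R : realType}.

Lemma first_coordsE n k (p : R) (hp : 1 <= p) (x : pball n p) :
  set_val (first_coords k hp x) = row_of k (coords x).
Proof.
apply/rowP => i; rewrite /= !mxE.
case: insubP => [j jn ji|].
  by rewrite -ji -tnth_nth tnth_mktuple.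
by rewrite -leqNgt => ni; rewrite nth_default// size_tuple.
Qed.

Lemma sign_root_nth n (p : R) q i : (i < n)%N ->
  (@sign_root R n p q)`_i = (-1) ^+ nth false q.2 i * q.1`_i `^ p^-1.
Proof.
move=> ni; rewrite -(tnth_nth 0 (sign_root p q) (Ordinal ni)) tnth_mktuple.
by rewrite (tnth_nth false) (tnth_nth 0).
Qed.

(** For 0 <= z <= x + y the ratio z / (x + y) is at most 1, so its p-th power is at most itself; add
    the cases z = x and z = y. *)
Lemma powR_superadd (p x y : R) : 1 <= p -> 0 <= x -> 0 < y ->
  x `^ p + y `^ p <= (x + y) `^ p.
Proof.
move=> p1 x0 y0; have xy0 : 0 < x + y by lra.
have h z : 0 <= z -> z <= x + y -> z `^ p <= z / (x + y) * (x + y) `^ p.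
  move=> z0 zxy; have [->|zN0] := eqVneq z 0.
    by rewrite powR0 ?mul0r// gt_eqF// (lt_le_trans _ p1).
  rewrite -{1}(divfK (lt0r_neq0 xy0) z) ge1r_powRZ// ?(ltW xy0)//.
  apply/andP; split; last by rewrite ler_pdivrMr// mul1r.
  by rewrite divr_gt0// lt0r zN0.
have hx := h x x0 (_ : x <= x + y); have hy := h y (ltW y0) (_ : y <= x + y).
apply: (le_trans (lerD (hx _) (hy _))); [lra|lra|].
by rewrite -mulrDl -mulrDl divff ?mul1r// gt_eqF.
Qed.

Variables (p : R) (hp : 1 <= p) (k : nat) (a b : nat -> nat -> R).
Hypothesis ab_gt0 : forall N j, (k <= N)%N -> (1 <= j <= N)%N ->
     0 < a N j /\ 0 < b N j.
Hypothesis a_const : forall N M j, (k <= N)%N -> (k <= M)%N -> (1 <= j <= k)%N ->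
     a N j = a M j.
Hypothesis b_asymp : forall j, (1 <= j <= k)%N ->
     (fun N => p * b N j : R^o) = (fun N => N%:R : R^o) +o_\oo
       (fun N => N%:R : R^o).
Variables (d : nat -> measure_display) (T : forall N, measurableType (d N))
  (P : forall N, probability (T N) R) (X : forall N, T N -> pball N p).
Hypothesis X_law : forall N, (k <= N)%N -> has_pGD_law (P N) (a N) (b N) (@X N).

Local Notation Y := (fun N w => first_coords k hp (@X N w)).
Let p0 : 0 < p. Proof. exact: lt_le_trans hp. Qed.

Lemma law_preimage N A : (k <= N)%N -> measurable A ->
  measurable ((coords \o @X N) @^-1` A) /\
  P N ((coords \o @X N) @^-1` A) = pGD N p (a N) (b N) A.
Proof.
move=> kN mA; have [mX XE] := X_law kN; split.
  by rewrite -[X in measurable X]setTI; exact: mX.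
by rewrite -XE.
Qed.

Lemma law_mass N : (k <= N)%N -> GD N (a N) (b N) setT = 1%E.
Proof.
move=> kN; rewrite -(pGD_setT _ p).
have [_ <-] := law_preimage kN (@measurableT _ (N.-tuple R)).
by rewrite preimage_setT probability_setT.
Qed.

Lemma preimage_first_coords N (U : set 'rV[R]_k) :
  @Y N @^-1` (set_val @^-1` U) =
  (coords \o @X N) @^-1` [set t : N.-tuple R | U (row_of k t)].
Proof. by apply/seteqP; split => w /=; rewrite -(first_coordsE k hp). Qed.

(** By [rate_ge], F lies in the set where the sum of the |x_i|^p is at least 1 - exp (- p m), which
    is a [heavy] event for rho. Closedness of F makes its preimage measurable. *)
Lemma first_coords_upper (F : set (pball k p)) (m : R) : closed F -> 0 <= m ->
  (forall x, F x -> m <= - p^-1 * ln (1 - pnorm p (set_val x) `^ p)) ->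
  (limn_esup (fun N => (N%:R^-1)%:E * lne (P N (@Y N @^-1` F))) <= (- m)%:E)%E.
Proof.
move=> cF m0 Fm; apply: limn_esup_le => e e0.
have [U oU UF] : open (~` F) by exact: closed_openC.
near=> N.
have kN : (k <= N)%N by near: N; exists k.
have N0 : (0 < N)%N by near: N; exists 1%N.
apply: scaled_lne_le => //; rewrite measure_ge0/=.
pose A := [set t : N.-tuple R | 1 - expR (- (p * m)) <= \sum_(i < k) `|t`_i| `^ p].
have mA : measurable A.
  apply: measurable_ge_set.
  apply: (@measurable_sum_nth _ N k (fun=> fun x => `|x| `^ p)) => i.
  by apply: (measurableT_comp (measurable_powR _)); exact: normr_measurable.
have [mXA PA] := law_preimage kN mA.
have mU := @measurable_row_open R N k U oU.
have [mXU _] := law_preimage kN mU.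
have FE : @Y N @^-1` F =
    ~` ((coords \o @X N) @^-1` [set t : N.-tuple R | U (row_of k t)]).
  by rewrite -preimage_first_coords UF preimage_setC setCK.
apply: (@le_trans _ _ (P N ((coords \o @X N) @^-1` A))).
  apply: le_measure; rewrite ?inE//.
    by rewrite FE; exact: measurableC.
  move=> w Fw; have := Fm _ Fw; rewrite rate_ge//; last exact: set_valP.
  rewrite /A/= first_coordsE => /le_trans; apply.
  by apply: ler_sum => i _; rewrite mxE.
rewrite PA.
apply: (@le_trans _ _ (GD N (a N) (b N) (heavy k (1 - expR (- (p * m)))%R))).
  apply: pGD_le => //; first exact: measurable_heavy.
  move=> q [q0 _]; rewrite /A /heavy/= sum_take// => /le_trans; apply.
  apply: ler_sum => i _; have iN := leq_trans (ltn_ord i) kN.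
  have := q0 (Ordinal iN); rewrite (tnth_nth 0)/= => qi0.
  rewrite sign_root_nth// normrM normrX normrN1 expr1n mul1r.
  by rewrite ger0_norm ?powR_ge0// -powRrM mulVf ?gt_eqF// powRr1// ltW.
near: N; exact: (near_GD_heavy hp ab_gt0 a_const b_asymp law_mass).
Unshelve. all: by end_near. Qed.

(** A box for rho next to the |x_i|^p, with matching signs, is mapped into O; its probability is at
    least of order s^(N/p), with s slightly below 1 minus the sum of the |x_i|^p. *)
Lemma first_coords_lower (O : set (pball k p)) (x : pball k p) : open O -> O x ->
  ((- (- p^-1 * ln (1 - pnorm p (set_val x) `^ p)))%:E <=
   limn_einf (fun N => (N%:R^-1)%:E * lne (P N (@Y N @^-1` O))))%E.
Proof.
move=> oO Ox; apply: limn_einf_ge => e e0.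
move: oO => [U oU UO].
have Ux : U (set_val x) by have : O x by []; rewrite -UO.
have : nbhs (set_val x) U by apply: open_nbhs_nbhs.
move=> /nbhs_ballP[r /= r0 rU].
have xb : pball k p (set_val x) by exact: set_valP.
pose xs (i : nat) : R := if insub i is Some j then set_val x 0 j else 0.
have xsE (i : 'I_k) : xs i = set_val x 0 i by rewrite /xs valK.
rewrite pnormX//; set s0 := 1 - _.
have s00 : 0 < s0 by rewrite subr_gt0 pball_sum_lt1.
(* Shrinking [s0] by this factor costs e / 2 in the exponent and frees the mass s0 (1 - ex) for the
   widths of the box. *)
pose ex := expR (- (p * (e / 2))).
have ex0 : 0 < ex by exact: expR_gt0.
have ex1 : ex < 1 by rewrite expR_lt1 oppr_lt0 mulr_gt0// divr_gt0.
have k1 : 0 < k%:R + 1 :> R by rewrite ltr_wpDl.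
(* By superadditivity of the p-th power, rho in [u_i, v_i] implies
   |x_i| <= rho^(1/p) <= |x_i| + dl. *)
pose dl := minr (r / 2) (minr 1 (s0 * (1 - ex) / (k%:R + 1))).
have dl0 : 0 < dl.
  by rewrite !lt_min divr_gt0// ltr01/= divr_gt0// mulr_gt0// subr_gt0.
have dl1 : dl <= 1 by rewrite !ge_min lexx/= orbT.
have dlr : dl < r.
  have : dl <= r / 2 by rewrite ge_min lexx.
  by lra.
have dlk : k%:R * dl <= s0 * (1 - ex).
  have : dl * (k%:R + 1) <= s0 * (1 - ex).
    by rewrite -ler_pdivlMr// !ge_min lexx !orbT.
  by lra.
have dlp : 0 < dl `^ p by exact: powR_gt0.
have dlp1 : dl `^ p <= dl by apply: ge1r_powR => //; rewrite dl0.
(* The offset keeps the lower end positive even where x_i = 0. *)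
pose u (i : nat) := `|xs i| `^ p + dl `^ p / 2.
pose v (i : nat) := `|xs i| `^ p + dl `^ p.
pose s := s0 * ex.
have s_gt0 : 0 < s by exact: mulr_gt0.
have uv i : (i < k)%N -> 0 < u i < v i.
  by move=> _; have := powR_ge0 `|xs i| p; rewrite /u /v; lra.
have sv : s + \sum_(0 <= i < k) v i <= 1.
  rewrite big_mkord big_split/=.
  rewrite (eq_bigr (fun i : 'I_k => `|set_val x 0 i| `^ p)); last first.
    by move=> i _; rewrite xsE.
  rewrite sumr_const card_ord -mulr_natl.
  have : k%:R * dl `^ p <= s0 * (1 - ex) by apply: le_trans dlk; rewrite ler_wpM2l.
  by rewrite /s /s0; lra.
have lns : p^-1 * ln s = p^-1 * ln s0 - e / 2.
  rewrite /s lnM ?posrE// /ex expRK; field; exact: lt0r_neq0.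
have e2 : 0 < e / 2 by rewrite divr_gt0.
near=> N.
have kN : (k <= N)%N by near: N; exists k.
have N0 : (0 < N)%N by near: N; exists 1%N.
apply: scaled_lne_ge => //.
have -> : - (- p^-1 * ln s0) - e = p^-1 * ln s - e / 2 by rewrite lns; lra.
rewrite -UO preimage_first_coords.
have mU := @measurable_row_open R N k U oU.
have [_ ->] := law_preimage kN mU.
(* The signs are made to agree with those of x, zero counting as positive, so that only absolute
   values remain to be compared. *)
pose E := [set t : N.-tuple bool | forall i, (i < k)%N -> nth false t i = (xs i < 0)].
have mbox : measurable [set t : N.-tuple R | inbox k u v t].
  by rewrite -[X in measurable X]setTI;
    exact: (@measurable_inbox _ N k u v measurableT [set true]).
have mE : measurable E.
  rewrite (_ : E = \bigcap_(i in [set: 'I_k]) ((fun t : N.-tuple bool =>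
      tnth t (widen_ord kN i)) @^-1` [set (xs i < 0)])); last first.
    apply/seteqP; split => t /=.
      by move=> h i _ /=; rewrite (tnth_nth false)/= h.
    by move=> h i ik; have := h (Ordinal ik) I; rewrite /= (tnth_nth false).
  apply: fin_bigcap_measurable => // i _; rewrite -[X in measurable X]setTI.
  exact: measurable_tnth.
apply: (@le_trans _ _ (GD N (a N) (b N) [set t | inbox k u v t] * ((2^-1) ^+ k)%:E)%E).
  near: N; exact: (near_GD_inbox hp ab_gt0 a_const b_asymp law_mass).
rewrite -(coin_prefix (fun i => xs i < 0) kN); apply: pGD_ge => //.
move=> q /= /allP qb qE; apply: rU; split => // i j; rewrite (ord1 i) /ball/=.
rewrite mxE -xsE.
have := qb j; rewrite mem_iota/= => /(_ (ltn_ord j)) /andP[uq qv].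
have jN := leq_trans (ltn_ord j) kN.
rewrite sign_root_nth// qE//.
set y := q.1`_j in uq qv *.
have y0 : 0 <= y.
  by apply: le_trans uq; rewrite /u; have := powR_ge0 `|xs j| p; lra.
have pV : 0 <= p^-1 by rewrite invr_ge0 ltW.
have y1 : `|xs j| <= y `^ p^-1.
  have -> : `|xs j| = (`|xs j| `^ p) `^ p^-1.
    by rewrite -powRrM divff ?gt_eqF// powRr1.
  apply: ge0_ler_powR => //; rewrite ?nnegrE ?powR_ge0//.
  by apply: le_trans uq; rewrite /u; lra.
have y2 : y `^ p^-1 <= `|xs j| + dl.
  have -> : `|xs j| + dl = ((`|xs j| + dl) `^ p) `^ p^-1.
    by rewrite -powRrM divff ?gt_eqF// powRr1// addr_ge0// ltW.
  apply: ge0_ler_powR => //; rewrite ?nnegrE ?powR_ge0//.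
  by apply: (le_trans qv); exact: powR_superadd.
have [xj0|xj0] := ltP (xs j) 0.
  rewrite expr1 mulN1r opprK ltr_norml; move: y1 y2; rewrite (ltr0_norm xj0); lra.
rewrite expr0 mul1r ltr_norml; move: y1 y2; rewrite (ger0_norm xj0); lra.
Unshelve. all: by end_near. Qed.

End ldp.

Theorem theorem3p4 (R : realType) (p : R) (hp : 1 <= p) (k : nat)
  (hk : (1 <= k)%N)
  (a b : nat -> nat -> R)
  (ab_gt0 : forall N j, (k <= N)%N -> (1 <= j <= N)%N ->
     0 < a N j /\ 0 < b N j)
  (a_const : forall N M j, (k <= N)%N -> (k <= M)%N -> (1 <= j <= k)%N ->
     a N j = a M j)
  (b_asymp : forall j, (1 <= j <= k)%N ->
     (fun N => p * b N j : R^o) = (fun N => N%:R : R^o) +o_\oo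
       (fun N => N%:R : R^o))
  (d : nat -> measure_display) (T : forall N, measurableType (d N))
  (P : forall N, probability (T N) R)
  (X : forall N, T N -> pball N p)
  (X_law : forall N, (k <= N)%N -> has_pGD_law (P N) (a N) (b N) (X N)) :
  LDP P (fun N w => first_coords k hp (X N w))
    (fun x : pball k p =>
       (- p^-1 * ln (1 - pnorm p (set_val x) `^ p))%:E).
Proof.
have rate_ge0 (x : pball k p) :
    0 <= - p^-1 * ln (1 - pnorm p (set_val x) `^ p).
  rewrite rate_ge//; last exact: set_valP.
  rewrite mulr0 oppr0 expR0 subrr.
  by apply: sumr_ge0 => i _; exact: powR_ge0.
split.
- by move=> x; rewrite lee_fin.
- by move=> c; exact: rate_compact.
- move=> F cF.
  have upper (m : R) : 0 <= m -> (m%:E <= ereal_inf [set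
      (- p^-1 * ln (1 - pnorm p (set_val x) `^ p))%:E | x in F])%E ->
      (limn_esup (fun N => (N%:R^-1)%:E *
        lne (P N ((fun w => first_coords k hp (X N w)) @^-1` F))) <= (- m)%:E)%E.
    move=> m0 mF; apply: (first_coords_upper hp ab_gt0 a_const b_asymp X_law) => // x Fx.
    by rewrite -lee_fin; apply: (le_trans mF); apply: ereal_inf_lbound; exists x.
  have inf0 : (0 <= ereal_inf [set
      (- p^-1 * ln (1 - pnorm p (set_val x) `^ p))%:E | x in F])%E.
    by apply: le_ereal_inf_tmp => _ [x Fx <-]; rewrite lee_fin.
  move: inf0 upper; case: ereal_inf => [m| |]//= => [m0|_] upper.
    by apply: upper.
  (* Here the infimum is infinite, so the bound holds for every real m >= 0. This excludes the
     limsup +oo by m = 0 and a finite l by m = |l| + 1. *)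
  move: upper; case: limn_esup => [l| |]// upper; last first.
    by have := upper 0 (lexx 0) (leey _).
  have l0 : 0 <= `|l| + 1 by rewrite addr_ge0.
  exfalso; have := upper _ l0 (leey _); rewrite lee_fin.
  by have := ler_norm (- l); rewrite normrN; lra.
- move=> O oO; rewrite leeNl; apply: le_ereal_inf_tmp => _ [x Ox <-].
  rewrite leeNl -EFinN.
  exact: (first_coords_lower hp ab_gt0 a_const b_asymp X_law oO Ox).
Qed.
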